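(* Let $\Omega\subset S^n$ be a nonempty open convex set of diameter $<\pi/2$, let $\mathcal{P}$ be the set of supporting hyperplanes of $\Omega$, and let $F$ be the spherical Funk metric of $\Omega$. For $x\in\Omega$ and $\xi\in T_x\Omega$ let $$p_{\Omega,x}(\xi)=\sup_{\pi\in\mathcal{P}}\frac{\cos d(x,T(x,\xi,\pi))}{\sin d(x,T(x,\xi,\pi))}\,\|\xi\|,$$ or equivalently $$p_{\Omega,x}(\xi)=\sup_{\pi\in\mathcal{P}}\frac{\cos d(x,\pi)}{\sin d(x,\pi)}\,\langle\eta_\pi(x),\xi\rangle .$$ Then the Finsler distance induced by $p_{\Omega,x}$ coincides with $F$: for all $x,y\in\Omega$, $$F(x,y)=\inf_{\sigma}\int_a^b p_{\Omega,\sigma(t)}(\dot\sigma(t))\,dt,$$ where the infimum is over all piecewise $C^1$ curves $\sigma:[a,b]\to\Omega$ with $\sigma(a)=x$ and $\sigma(b)=y$.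
   Context: $S^n$ is the unit sphere (curvature $+1$) with angular distance $d$, Riemannian inner product $\langle\cdot,\cdot\rangle$ and norm $\|\cdot\|$; $d(x,\pi)$ is the distance from $x$ to the set $\pi$. A hyperplane in $S^n$ is a complete totally geodesic codimension-one subspace (a great sphere); an open half-space is a connected component of the complement of a hyperplane. A subset of $S^n$ is convex if it is contained in an open half-space and every pair of its points can be connected by a geodesic contained in it. A supporting hyperplane of $\Omega$ is a hyperplane that contains a boundary point of $\Omega$ and such that $\Omega$ is contained in one of the two open half-spaces it bounds. For $\xi\neq0$, $T(x,\xi,\pi)$ is the first point where the geodesic ray $\{\exp_x(t\xi):t>0\}$ meets $\pi$; for $\xi=0$ one sets $p_{\Omega,x}(0)=0$. $\eta_\pi(x)$ is the unit tangent vector at $x$ whose direction is opposite to the gradient of $d(\cdot,\pi)$ at $x$ (when $d(x,\pi)=\pi/2$ the corresponding term in the second supremum is taken to be $0$). For distinct $x,y\in\Omega$, $b(x,y)$ is the first intersection point of $\partial\Omega$ with the geodesic ray from $x$ through $y$. The spherical Funk metric is $F(x,y)=\log\dfrac{\sin d(x,b(x,y))}{\sin d(y,b(x,y))}$ for $x\neq y$, and $F(x,x)=0$. *)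

(* Defs.v *)
From mathcomp Require Import all_boot all_order all_algebra.
From mathcomp Require Import all_classical all_reals all_analysis.
Import Order.TTheory GRing.Theory Num.Theory numFieldNormedType.Exports.

Set Implicit Arguments.
Unset Strict Implicit.
Unset Printing Implicit Defensive.

Local Open Scope classical_set_scope.
Local Open Scope ring_scope.

(* S^n is the Euclidean unit sphere of R^(n+1) = 'rV[R]_n.+1, and T_x S^n is
   the orthogonal complement of x. The library norm `|x| on row vectors is the
   sup norm; it is used for the topology only. *)
Section Sphere.
Context {R : realType} {n : nat}.
Local Notation V := 'rV[R]_n.+1.
Implicit Types (x y z v xi : V) (A P Omega : set V).

Definition dot x y : R := \sum_i x ord0 i * y ord0 i.

Definition enorm x : R := Num.sqrt (dot x x).

Definition sphere : set V := [set x | dot x x = 1].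

Definition tangent x : set V := [set xi | dot x xi = 0].

Definition sdist x y : R := acos (dot x y).

Definition sdist_set x A : R := inf [set sdist x z | z in A].

Definition sdiam A : R := sup [set sdist x y | x in A & y in A].

(* At xi = 0 the value is x, since enorm 0 = 0. *)
Definition sexp x xi : V :=
  cos (enorm xi) *: x + (sin (enorm xi) / enorm xi) *: xi.

(* Open for the subspace topology of the sphere. *)
Definition sopen A : Prop := exists2 U : set V, open U & A = U `&` sphere.

(* The sphere being closed, this is the boundary of A relative to S^n. *)
Definition sboundary A : set V := closure A `&` closure (sphere `\` A).

Definition great_sphere v : set V := [set z | sphere z /\ dot v z = 0].

Definition hyperplane P : Prop := exists2 v : V, v != 0 & P = great_sphere v.

(* H is an open half-space bounded by the hyperplane P. *)
Definition half_space_of P (H : set V) : Prop :=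
  exists2 z, (sphere `\` P) z & H = connected_component (sphere `\` P) z.

Definition half_space (H : set V) : Prop :=
  exists2 P, hyperplane P & half_space_of P H.

(* The geodesics starting at x are the curves t |-> sexp x (t *: xi). *)
Definition geodesically_joined A x y : Prop :=
  exists xi, [/\ tangent x xi, sexp x xi = y &
    forall t : R, 0 <= t <= 1 -> A (sexp x (t *: xi))].

Definition sconvex A : Prop :=
  (exists2 H, half_space H & A `<=` H) /\
  (forall x y, A x -> A y -> geodesically_joined A x y).

Definition supporting_hyperplane Omega P : Prop :=
  [/\ hyperplane P, (sboundary Omega `&` P) !=set0 &
      exists2 H, half_space_of P H & Omega `<=` H].

Definition is_first_hit x xi A z : Prop :=
  exists t : R, [/\ 0 < t, z = sexp x (t *: xi), A z &
    forall s : R, 0 < s < t -> ~ A (sexp x (s *: xi))].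

(* T(x, xi, A); arbitrary if the ray does not meet A, or has no first such
   point. *)
Definition first_hit x xi A : V := get (is_first_hit x xi A).

(* Riemannian gradient at x of a function on the sphere; it is unique when it
   exists. *)
Definition is_gradient (f : V -> R) x (g : V) : Prop :=
  tangent x g /\ forall xi, tangent x xi ->
    is_derive (0 : R) (1 : R) (fun t : R => f (sexp x (t *: xi))) (dot g xi).

Definition gradient (f : V -> R) x : V := get (is_gradient f x).

(* Meaningful for 0 < sdist_set x P < pi / 2, where the distance to the
   hyperplane P has a nonzero gradient at x. *)
Definition eta P x : V :=
  let g := gradient (sdist_set ^~ P) x in - ((enorm g)^-1 *: g).

(* p_{Omega,x}(xi), as a supremum in \bar R so that no boundedness is built in.
   The convention p_{Omega,x}(0) = 0 is applied in both expressions; it matters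
   only when Omega has no supporting hyperplane, that is, when n = 0. *)
Definition finsler_hit Omega x xi : \bar R :=
  if xi == 0 then 0%E else
  ereal_sup [set (let r := sdist x (first_hit x xi P) in
                  cos r / sin r * enorm xi)%:E
            | P in supporting_hyperplane Omega].

Definition finsler_eta Omega x xi : \bar R :=
  if xi == 0 then 0%E else
  ereal_sup [set (let r := sdist_set x P in
                  if r == pi / 2 then 0
                  else cos r / sin r * dot (eta P x) xi)%:E
            | P in supporting_hyperplane Omega].

(* b(x, y): the vector y - <x, y> x is the component of y tangent at x, and
   the geodesic ray it directs passes through y at angle sdist x y < pi. *)
Definition boundary_hit Omega x y : V :=
  first_hit x (y - dot x y *: x) (sboundary Omega).

Definition funk Omega x y : R :=
  if x == y then 0 else
  let b := boundary_hit Omega x y in ln (sin (sdist x b) / sin (sdist y b)).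

(* C^1 up to the endpoints of [a, b]; the values of sigma outside [a, b] are
   irrelevant. *)
Definition C1_on (a b : R) (sigma : R -> V) : Prop :=
  {within `[a, b], continuous sigma} /\
  exists2 dsigma : R -> V, {within `[a, b], continuous dsigma} &
    forall t : R, a < t < b -> is_derive t (1 : R) sigma (dsigma t).

Definition piecewise_C1_on (a b : R) (sigma : R -> V) : Prop :=
  exists2 s : seq R, itv_partition a b s &
    forall i, (i < size s)%N ->
      C1_on (nth b (a :: s) i) (nth b (a :: s) i.+1) sigma.

Definition curve_from_to Omega x y (a b : R) (sigma : R -> V) : Prop :=
  [/\ a < b, piecewise_C1_on a b sigma, sigma @` `[a, b] `<=` Omega,
      sigma a = x & sigma b = y].

(* The finitely many t where sigma need not be differentiable are negligible
   in the integral. *)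
Definition finsler_length (p : V -> V -> \bar R) (a b : R) (sigma : R -> V)
    : \bar R :=
  (\int[lebesgue_measure]_(t in `[a, b]) p (sigma t) (derive1 sigma t))%E.

Definition finsler_dist Omega (p : V -> V -> \bar R) x y : \bar R :=
  ereal_inf [set l | exists (a b : R) (sigma : R -> V),
    curve_from_to Omega x y a b sigma /\ l = finsler_length p a b sigma].

End Sphere.

(* Main.v *)
Require Import Defs.
From mathcomp Require Import all_boot all_order all_algebra.
From mathcomp Require Import all_classical all_reals all_analysis.
From mathcomp Require Import measurable_realfun ring lra.
Import Order.TTheory GRing.Theory Num.Theory numFieldNormedType.Exports.

Set Implicit Arguments.
Unset Strict Implicit.
Unset Printing Implicit Defensive.

Local Open Scope classical_set_scope.
Local Open Scope ring_scope.

(** Everything is expressed in the ambient space R^(n+1), where a supporting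
    hyperplane of Omega is the orthogonal great sphere of a vector v with
    <v, w> > 0 for all w in Omega.  Both expressions under the suprema are then
    the same linear form: at x, for a tangent vector xi, each of them equals
      - <v, xi> / <v, x>,
    that is, minus the derivative at x, along xi, of ln <v, .>.  For the first
    one, <v, .> restricted to the geodesic from x is the sinusoid
    <v, x> cos r + (<v, xi> / |xi|) sin r, which gives the cotangent of its
    first zero ([first_hit_great_sphere]); for the second one, the distance to
    the hyperplane is asin <v, .> when v is a unit vector
    ([eta_great_sphere]).  So the two suprema agree term by term.

    Let x and y be distinct points of Omega, let b be the boundary point hit by
    the geodesic from x through y, and let l and d be the distances from x to b
    and to y ([funk_chord]); then F(x, y) = ln (sin l / sin (l - d)).  The cone
    over Omega is open and convex, so a separation argument ([exists_support])
    yields a supporting hyperplane at b, with vector v.  As <v, .> vanishes at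
    b, it is proportional to sin (l - t) along the geodesic, whence
    F(x, y) = ln (<v, x> / <v, y>).

    Lower bound: the metric dominates - <v, xi> / <v, x>, whose integral along
    any curve from x to y is ln (<v, x> / <v, y>)
    ([log_functional_le_length]).  Upper bound: on the geodesic from x to y, at
    time t, the form attached to the hyperplane at b is the largest, because
    any other vector w that is positive on Omega satisfies <w, b> >= 0; so the
    metric equals cot (l - t) there ([finsler_hit_great_arc]), and the length
    of the geodesic is exactly F(x, y) ([great_arc_length]). *)

(** * The ambient inner product *)

Section DotTheory.
Context {R : realType} {n : nat}.
Local Notation V := 'rV[R]_n.+1.
Implicit Types (x y z v w xi : V) (a b t : R).

Lemma dotC x y : dot x y = dot y x.
Proof. by apply: eq_bigr => i _; rewrite mulrC. Qed.

Lemma dotDr x y z : dot x (y + z) = dot x y + dot x z.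
Proof. by rewrite -big_split; apply: eq_bigr => i _; rewrite !mxE mulrDr. Qed.

Lemma dotZr a x y : dot x (a *: y) = a * dot x y.
Proof. by rewrite mulr_sumr; apply: eq_bigr => i _; rewrite !mxE mulrCA. Qed.

Lemma dotNr x y : dot x (- y) = - dot x y.
Proof. by rewrite -scaleN1r dotZr mulN1r. Qed.

Lemma dotBr x y z : dot x (y - z) = dot x y - dot x z.
Proof. by rewrite dotDr dotNr. Qed.

Lemma dotDl x y z : dot (y + z) x = dot y x + dot z x.
Proof. by rewrite dotC dotDr !(dotC x). Qed.

Lemma dotZl a x y : dot (a *: y) x = a * dot y x.
Proof. by rewrite dotC dotZr (dotC x). Qed.

Lemma dotNl x y : dot (- y) x = - dot y x.
Proof. by rewrite dotC dotNr dotC. Qed.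

Lemma dotBl x y z : dot (y - z) x = dot y x - dot z x.
Proof. by rewrite dotDl dotNl. Qed.

Lemma dot0r x : dot x 0 = 0.
Proof. by rewrite -(scale0r 0) dotZr mul0r. Qed.

Lemma dot0l x : dot 0 x = 0.
Proof. by rewrite dotC dot0r. Qed.

Lemma dot_ge0 x : 0 <= dot x x.
Proof. by apply: sumr_ge0 => i _; rewrite -expr2 sqr_ge0. Qed.

Lemma dot_eq0 x : (dot x x == 0) = (x == 0).
Proof.
apply/eqP/eqP => [x0|->]; last exact: dot0r.
apply/rowP => i; rewrite mxE.
have x_ge0 j : true -> 0 <= x ord0 j * x ord0 j by rewrite -expr2 sqr_ge0.
by have /eqP := psumr_eq0P x_ge0 x0 isT (i := i); rewrite -expr2 sqrf_eq0 => /eqP.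
Qed.

Lemma dot_gt0 x : (0 < dot x x) = (x != 0).
Proof. by rewrite lt_def dot_ge0 andbT dot_eq0. Qed.

Lemma enorm_ge0 x : 0 <= enorm x.
Proof. exact: sqrtr_ge0. Qed.

Lemma enorm_eq0 x : (enorm x == 0) = (x == 0).
Proof. by rewrite sqrtr_eq0 le_eqVlt dot_eq0 ltNge dot_ge0 orbF. Qed.

Lemma enorm_gt0 x : (0 < enorm x) = (x != 0).
Proof. by rewrite lt_def enorm_ge0 andbT enorm_eq0. Qed.

Lemma enorm2 x : enorm x ^+ 2 = dot x x.
Proof. by rewrite sqr_sqrtr// dot_ge0. Qed.

Lemma enormZ a x : enorm (a *: x) = `|a| * enorm x.
Proof. by rewrite /enorm dotZl dotZr mulrA -expr2 sqrtrM ?sqr_ge0// sqrtr_sqr. Qed.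

Lemma enorm1 x : dot x x = 1 -> enorm x = 1.
Proof. by rewrite /enorm => ->; rewrite sqrtr1. Qed.

Lemma sphere_neq0 x : sphere x -> x != 0.
Proof. by rewrite /sphere /= -dot_eq0 => ->; rewrite oner_eq0. Qed.

Lemma sphere_normalize x : x != 0 -> sphere ((enorm x)^-1 *: x).
Proof.
move=> x0; rewrite /sphere /= dotZl dotZr -enorm2 mulrA -expr2 -exprMn.
by rewrite mulVf ?expr1n// enorm_eq0.
Qed.

(** Expand the squared norm of [dot y y *: x - dot x y *: y]. *)
Lemma cauchy_schwarz x y : (dot x y) ^+ 2 <= dot x x * dot y y.
Proof.
have [->|y0] := eqVneq y 0; first by rewrite !dot0r expr0n mulr0.
have y1 : 0 < dot y y by rewrite dot_gt0.
have := dot_ge0 (dot y y *: x - dot x y *: y).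
rewrite !(dotBl, dotBr, dotZl, dotZr) (dotC y x) => h.
rewrite -subr_ge0 -(pmulr_rge0 _ y1).
by apply: le_trans h _; rewrite le_eqVlt; apply/orP; left; apply/eqP; ring.
Qed.

Lemma dot_sphere_le1 x y : sphere x -> sphere y -> -1 <= dot x y <= 1.
Proof.
move=> x1 y1; rewrite -ler_norml -(@ler_pXn2r _ 2)// ?nnegrE// expr1n.
by rewrite real_normK ?num_real//; have := cauchy_schwarz x y; rewrite x1 y1 mulr1.
Qed.

Lemma dot_continuous v : continuous (dot v).
Proof.
have -> : dot v = \sum_i (fun x : V => v ord0 i * x ord0 i).
  by apply/funext => x; rewrite fct_sumE.
elim/big_ind : _ => [x|f g cf cg x|i _ x].
- exact: (@cst_continuous V R 0 x).
- by apply: (@continuousD R R^o V f g x); [exact: cf|exact: cg].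
- by apply: (@continuousM R V (fun=> v ord0 i) (fun u => u ord0 i));
    [exact: cst_continuous|exact: coord_continuous].
Qed.

Lemma dot_self_continuous : continuous (fun x : V => dot x x).
Proof.
have -> : (fun x : V => dot x x) = \sum_i (fun x : V => x ord0 i * x ord0 i).
  by apply/funext => x; rewrite fct_sumE.
elim/big_ind : _ => [x|f g cf cg x|i _ x].
- exact: (@cst_continuous V R 0 x).
- by apply: (@continuousD R R^o V f g x); [exact: cf|exact: cg].
- by apply: (@continuousM R V (fun u => u ord0 i) (fun u => u ord0 i));
    exact: coord_continuous.
Qed.

Lemma enorm_continuous : continuous (@enorm R n).
Proof.
move=> x; apply: (@continuous_comp _ _ _ (fun x : V => dot x x)).
  exact: dot_self_continuous.
exact: sqrt_continuous.
Qed.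

(** Lets the calculus of real functions act on curves coordinate by
    coordinate. *)
Lemma is_derive_rV (s : R -> V) t (d : V) :
  is_derive t (1 : R) s d <->
  forall i, is_derive t (1 : R) (fun u => s u ord0 i) (d ord0 i).
Proof.
split=> [[dv e] i|h].
  apply: DeriveDef; first by move/derivable_mxP : dv; exact.
  by rewrite -e derive_mx// mxE.
have dv : derivable s t 1.
  by apply/derivable_mxP => i j; rewrite ord1; have [] := h j.
apply: DeriveDef => //; rewrite derive_mx//; apply/rowP => i; rewrite mxE.
by have [_ ->] := h i.
Qed.

Lemma is_derive_dot v (s : R -> V) t (d : V) :
  is_derive t (1 : R) s d -> is_derive t (1 : R) (fun u => dot v (s u)) (dot v d).
Proof.
move=> /is_derive_rV h.
have -> : (fun u => dot v (s u)) = \sum_i (v ord0 i \*: (fun u => s u ord0 i : R^o)).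
  by apply/funext => u; rewrite fct_sumE.
apply: is_derive_sum => i; apply: is_deriveZ; exact: h.
Qed.

Lemma is_derive_dot_self (s : R -> V) t (d : V) :
  is_derive t (1 : R) s d ->
  is_derive t (1 : R) (fun u => dot (s u) (s u)) (2 * dot (s t) d).
Proof.
move=> /is_derive_rV h.
have -> : (fun u => dot (s u) (s u)) =
    \sum_i ((fun u => s u ord0 i) * (fun u => s u ord0 i) : R -> R).
  by apply/funext => u; rewrite fct_sumE.
have -> : 2 * dot (s t) d =
    \sum_i (s t ord0 i *: (d ord0 i : R^o) + s t ord0 i *: (d ord0 i : R^o)).
  by rewrite /dot mulr_sumr; apply: eq_bigr => i _; rewrite -mulr2n mulr_natl.
by apply: is_derive_sum => i; apply: is_deriveM; exact: h.
Qed.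

Lemma is_derive_combination (f g : R -> R) x y t (df dg : R) :
  is_derive t (1 : R) f df -> is_derive t (1 : R) g dg ->
  is_derive t (1 : R) (fun u => f u *: x + g u *: y) (df *: x + dg *: y).
Proof.
move=> hf hg; apply/is_derive_rV => i; rewrite !mxE.
have -> : (fun u => (f u *: x + g u *: y) ord0 i) =
   (x ord0 i \*: (f : R -> R^o)) + (y ord0 i \*: (g : R -> R^o)).
  by apply/funext => u; rewrite !mxE !fctE /= mulrC [X in _ + X]mulrC.
by rewrite mulrC [dg * _]mulrC; apply: is_deriveD.
Qed.

End DotTheory.

(** * Separation from a closed convex cone *)

Section Separation.
Context {R : realType} {n : nat}.
Local Notation V := 'rV[R]_n.+1.
Implicit Types (x y z v w xi : V) (a b t : R).

(** Bounded sets, like the topology, come from the sup norm [`|v|]. *)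
Lemma norm_le_enorm v : `|v| <= enorm v.
Proof.
rewrite [leLHS]/Num.Def.normr/= mx_normrE; apply: bigmax_le => [|[i j] _ /=].
  exact: enorm_ge0.
rewrite ord1 -(@ler_pXn2r _ 2)// ?nnegrE ?enorm_ge0//.
rewrite real_normK ?num_real// enorm2 /dot (bigD1 j)//= expr2 lerDl.
by apply: sumr_ge0 => k _; rewrite -expr2 sqr_ge0.
Qed.

Lemma enorm_bounded_compact (A : set V) (M : R) :
  closed A -> (forall v, A v -> enorm v <= M) -> compact A.
Proof.
move=> clA bA; apply: bounded_closed_compact => //.
exists M; split; first exact: num_real.
by move=> N MN v /bA vM; apply: le_trans (norm_le_enorm v) (le_trans vM (ltW MN)).
Qed.

Lemma closed_dot_ge0 w : closed [set v | 0 <= dot v w].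
Proof.
rewrite (_ : mkset _ = dot w @^-1` [set r | 0 <= r]); last first.
  by apply/seteqP; split => v /=; rewrite dotC.
by apply: preimage_closed => [v _|]; [exact: dot_continuous|exact: closed_ge].
Qed.

(** The vector from [p] to its nearest point [q] in [C] does the job: moving from
    [q] along a ray of the cone, or shrinking [q], cannot decrease the distance
    to [p]. *)
Lemma cone_separation (C : set V) p : closed C -> C 0 ->
  (forall v w, C v -> C w -> C (v + w)) ->
  (forall a v, 0 <= a -> C v -> C (a *: v)) ->
  ~ C p -> exists v, (forall w, C w -> 0 <= dot v w) /\ dot v p < 0.
Proof.
move=> clC C0 CD CZ Cp.
pose f w := dot (w - p) (w - p).
have fcont : continuous f.
  move=> w; apply: (@continuous_comp _ _ _ (fun w : V => w - p) (fun w => dot w w)).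
    by apply: (@continuousD R V V id (fun=> - p)); [exact: id|exact: cst_continuous].
  exact: dot_self_continuous.
(* The origin competes for the minimum, so the part of C no farther from p
   than the origin suffices; it is compact. *)
pose A := C `&` [set w | f w <= dot p p].
have cA : compact A.
  apply: (@enorm_bounded_compact _ (2 * enorm p)) => [|v [_ fv]].
    apply: closedI => //; apply: (@preimage_closed _ _ f [set r | r <= dot p p]).
      by move=> w _; exact: fcont.
    exact: closed_le.
  rewrite -(@ler_pXn2r _ 2)// ?nnegrE ?enorm_ge0//; last first.
    by rewrite mulr_ge0// enorm_ge0.
  rewrite exprMn !enorm2.
  have := dot_ge0 (v - 2 *: p); move: fv => /=; rewrite /f.
  rewrite !(dotBl, dotBr, dotZl, dotZr) (dotC p v); lra.
have A0 : A 0 by split => //=; rewrite /f sub0r dotNl dotNr opprK.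
have [q] := @EVT_min_rV R _ f A (ex_intro _ _ A0) cA (continuous_subspaceT fcont).
rewrite inE => -[Cq fq] qmin.
have {}qmin w : C w -> f q <= f w.
  move=> Cw; have [fw|fw] := leP (f w) (dot p p); last exact: le_trans fq (ltW fw).
  by apply: qmin; rewrite inE.
(* First variation of f at its minimum q: the slope along an admissible
   direction w is nonnegative. *)
have key w : (forall t, 0 < t -> t < 1 -> C (q + t *: w)) -> 0 <= dot (q - p) w.
  move=> Cqw; rewrite leNgt; apply/negP => vw.
  pose B := dot w w; have B0 : 0 <= B by exact: dot_ge0.
  pose D := - dot (q - p) w; have D0 : 0 < D by rewrite oppr_gt0.
  (* f (q + t w) - f q = t (t B - 2 D), and t B < D < 2 D for this t < 1. *)
  pose t := D / (B + D + 1).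
  have t0 : 0 < t by rewrite divr_gt0//; lra.
  have BD : 0 < B + D + 1 by lra.
  have tE : t * (B + D + 1) = D by rewrite /t divfK// gt_eqF.
  have t1 : t < 1 by rewrite ltr_pdivrMr// mul1r; lra.
  have := qmin _ (Cqw t t0 t1).
  have -> : f (q + t *: w) = f q - 2 * t * D + t * t * B.
    rewrite /f /D /B !(dotBl, dotBr, dotDl, dotDr, dotZl, dotZr) (dotC w) (dotC p q).
    by rewrite (dotC p w); ring.
  have : t * B < 2 * D by nra.
  move=> h1 h2; have : t * (t * B) < t * (2 * D) by rewrite ltr_pM2l.
  lra.
have v_ge0 w : C w -> 0 <= dot (q - p) w.
  by move=> Cw; apply: key => t t0 _; apply: CD => //; apply: CZ => //; exact: ltW.
exists (q - p); split => //.
have /eqP vq : dot (q - p) q == 0.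
  rewrite eq_le v_ge0// andbT -oppr_ge0 -dotNr key// => t t0 t1.
  by rewrite scalerN -{1}(scale1r q) -scalerBl; apply: CZ => //; lra.
have v0 : q - p != 0.
  by apply/eqP => /subr0_eq qp; apply: Cp; rewrite -qp.
have -> : p = q - (q - p) by rewrite subKr.
by rewrite dotBr subKr vq sub0r oppr_lt0 dot_gt0.
Qed.

(** The parity of cos and sin removes the absolute value of [t] that comes from
    [enorm (t *: xi)]. *)
Lemma sexp_line x xi t : sexp x (t *: xi) =
  cos (t * enorm xi) *: x + (sin (t * enorm xi) / enorm xi) *: xi.
Proof.
have [->|xi0] := eqVneq xi 0.
  have e0 : enorm (0 : V) = 0 by apply/eqP; rewrite enorm_eq0.
  by rewrite !scaler0 /sexp e0 mulr0 scaler0.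
have e0 : enorm xi != 0 by rewrite enorm_eq0.
have [->|t0] := eqVneq t 0.
  have e00 : enorm (0 : V) = 0 by apply/eqP; rewrite enorm_eq0.
  by rewrite scale0r /sexp e00 scaler0 !mul0r sin0 mul0r scale0r.
rewrite /sexp enormZ scalerA.
have -> : cos (`|t| * enorm xi) = cos (t * enorm xi).
  by case: (ger0P t) => // _; rewrite mulNr cosN.
congr (_ + _ *: _); case: (ger0P t) => _; last rewrite mulNr sinN.
  by field; rewrite t0 e0.
by field; rewrite t0 e0.
Qed.

Lemma sexp_sphere x xi : sphere x -> tangent x xi -> sphere (sexp x xi).
Proof.
rewrite /sphere /tangent /sexp /= => x1 xxi.
rewrite !(dotDl, dotDr, dotZl, dotZr) (dotC xi) xxi x1 -enorm2.
have [->|e0] := eqVneq (enorm xi) 0; first by rewrite cos0 sin0; ring.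
by rewrite -[RHS](cos2Dsin2 (enorm xi)); field.
Qed.

End Separation.

(** * Supporting hyperplanes as positive linear forms *)

Section Supporting.
Context {R : realType} {n : nat}.
Local Notation V := 'rV[R]_n.+1.
Implicit Types (x y z v w xi b : V) (a t : R) (Omega P H : set V).

Definition positive_on Omega v := forall w, Omega w -> 0 < dot v w.

Lemma great_sphereN v : great_sphere (- v) = great_sphere v :> set V.
Proof.
by apply/seteqP; split => z [z1 vz]; split => //; move: vz;
  rewrite dotNl => /eqP; rewrite ?oppr_eq0 => /eqP // ->; rewrite oppr0.
Qed.

Lemma great_sphereZ a v : a != 0 -> great_sphere (a *: v) = great_sphere v :> set V.
Proof.
move=> a0; apply/seteqP; split => z [z1 vz]; split => //; move: vz; rewrite dotZl.
  by move=> /eqP; rewrite mulf_eq0 (negPf a0) => /eqP.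
by move=> ->; rewrite mulr0.
Qed.

(** The image of a connected component under [dot v] is an interval that avoids
    0. *)
Lemma half_space_sign v z x y :
  connected_component (sphere `\` great_sphere v) z x ->
  connected_component (sphere `\` great_sphere v) z y ->
  0 < dot v x -> 0 < dot v y.
Proof.
set H := connected_component _ z => Hx Hy vx; rewrite ltNge; apply/negP => vy.
have cH : connected (dot v @` H).
  apply: connected_continuous_connected; first exact: component_connected.
  by apply: continuous_subspaceT; exact: dot_continuous.
have /connected_intervalP iH := cH.
have [w Hw vw] : (dot v @` H) 0.
  by apply: (iH (dot v y) (dot v x)); [exists y|exists x|rewrite vy ltW].
have [w1] := connected_component_sub Hw; apply; split => //.
Qed.

Lemma half_space_positive P H Omega : hyperplane P -> half_space_of P H ->
  Omega `<=` H -> Omega !=set0 ->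
  exists v, [/\ v != 0, P = great_sphere v & positive_on Omega v].
Proof.
move=> [v v0 ->] [z _ ->] OH [x Ox].
have := connected_component_sub (OH _ Ox) => -[x1 nvx].
have [vx|vx|vx] := ltgtP 0 (dot v x).
- by exists v; split => // w /OH Hw; apply: half_space_sign vx; [exact: OH|].
- exists (- v); split; rewrite ?oppr_eq0 ?great_sphereN// => w /OH Hw.
  apply: (@half_space_sign _ z x); rewrite ?great_sphereN//; first exact: OH.
  by rewrite dotNl oppr_gt0.
- by exfalso; apply: nvx; split.
Qed.

Lemma supporting_positive Omega P : Omega !=set0 -> supporting_hyperplane Omega P ->
  exists v, [/\ dot v v = 1, P = great_sphere v & positive_on Omega v].
Proof.
move=> O0 [hP _ [H PH OH]].
have [v [v0 -> vO]] := half_space_positive hP PH OH O0.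
have e0 : 0 < enorm v by rewrite enorm_gt0.
exists ((enorm v)^-1 *: v); split.
- exact: sphere_normalize.
- by rewrite great_sphereZ// invr_neq0// gt_eqF.
- by move=> w /vO; rewrite dotZl; apply: mulr_gt0; rewrite invr_gt0.
Qed.

(** The formula also covers [xi = 0], since the second term then vanishes
    whatever its coefficient. *)
Lemma is_derive_sexp x xi t : is_derive t (1 : R) (fun t : R => sexp x (t *: xi))
  ((- (enorm xi * sin (t * enorm xi))) *: x + cos (t * enorm xi) *: xi).
Proof.
have -> : (fun t : R => sexp x (t *: xi)) = (fun t : R =>
    cos (t * enorm xi) *: x + (sin (t * enorm xi) / enorm xi) *: xi).
  by apply/funext => u; rewrite sexp_line.
have hm : is_derive t (1 : R) (fun u => u * enorm xi) (enorm xi).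
  have -> : (fun u => u * enorm xi) = (enorm xi \*: (id : R -> R^o)).
    by apply/funext => u /=; rewrite mulrC.
  by rewrite -[X in is_derive _ _ _ X]mulr1; exact: is_deriveZ.
have hs : is_derive t (1 : R) (fun u => sin (u * enorm xi))
    (cos (t * enorm xi) * enorm xi).
  exact: (@is_derive1_comp R sin).
have hc : is_derive t (1 : R) (fun u => cos (u * enorm xi))
    (- (enorm xi * sin (t * enorm xi))).
  rewrite mulrC -mulNr.
  exact: (@is_derive1_comp R cos).
have hs' : is_derive t (1 : R) (fun u => sin (u * enorm xi) / enorm xi)
    ((enorm xi)^-1 * (cos (t * enorm xi) * enorm xi)).
  have -> : (fun u => sin (u * enorm xi) / enorm xi) =
    ((enorm xi)^-1 \*: (fun u => sin (u * enorm xi) : R^o)).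
    by apply/funext => u /=; rewrite mulrC.
  exact: is_deriveZ.
have := is_derive_combination x xi hc hs'.
have [->|xi0] := eqVneq xi 0; first by rewrite !scaler0.
by rewrite mulrCA mulVf ?enorm_eq0// mulr1.
Qed.

Lemma sexp_path_continuous x xi : continuous (fun t : R => sexp x (t *: xi)).
Proof.
move=> t; apply: differentiable_continuous; apply/derivable1_diffP.
by have [] := is_derive_sexp x xi t.
Qed.

Lemma sphere_closed : closed (sphere : set V).
Proof.
apply: (@preimage_closed _ _ (fun x : V => dot x x) [set 1]).
  by move=> x _; exact: dot_self_continuous.
exact: closed_eq.
Qed.

(** To see that [Omega] lies in one component of the complement of the
    hyperplane, join its points to [x] by geodesics contained in [Omega]. *)
Lemma positive_supporting Omega v x b : Omega `<=` sphere ->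
  (forall y, Omega y -> geodesically_joined Omega x y) -> Omega x ->
  v != 0 -> positive_on Omega v -> sboundary Omega b -> dot v b = 0 ->
  supporting_hyperplane Omega (great_sphere v).
Proof.
move=> Os Oc Ox v0 vO bO vb; split; first by exists v.
  exists b; split => //; split => //; apply: sphere_closed.
  exact: closure_subset Os _ bO.1.
have OP : Omega `<=` sphere `\` great_sphere v.
  by move=> w Ow; split; [exact: Os|move=> [_ vw]; have := vO _ Ow; rewrite vw ltxx].
exists (connected_component (sphere `\` great_sphere v) x).
  by exists x; [exact: OP|].
move=> y /Oc[xi [xxi <- xiO]].
apply: (@connected_component_max _ _ ((fun t : R => sexp x (t *: xi)) @` `[0, 1])).
- exists 0 => /=; first by rewrite in_itv/= lexx ler01.
  by rewrite sexp_line mul0r cos0 sin0 mul0r scale0r scale1r addr0.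
- by move=> _ [t /= t01 <-]; apply: OP; apply: xiO; move: t01; rewrite in_itv.
- apply: connected_continuous_connected; first exact: segment_connected.
  by apply: continuous_subspaceT; exact: sexp_path_continuous.
- by exists 1; [rewrite /= in_itv/= lexx ler01|rewrite scale1r].
Qed.

End Supporting.

(** * The convex cone over Omega and its supporting forms *)

Section Convexity.
Context {R : realType} {n : nat}.
Local Notation V := 'rV[R]_n.+1.
Implicit Types (x y z v w xi b : V) (a t : R) (Omega P H : set V).

(** A spherical convex set contains the radial projections of the segments
    between its points.  The positive form [v] rules out geodesics of length at
    least pi, which would pass through [- x]; along the minor arc, the ratio of
    the two coordinates of the moving point takes every nonnegative value. *)
Lemma scaled_combination_mem Omega v x y a c : Omega `<=` sphere -> positive_on Omega v ->
  geodesically_joined Omega x y -> Omega x -> Omega y ->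
  0 <= a -> 0 <= c -> 0 < a + c ->
  exists2 r, 0 < r & Omega (r *: (a *: x + c *: y)).
Proof.
move=> Os vO [xi [xxi yE xiO]] Ox Oy a0 c0 ac0.
have [a00|a_neq0] := eqVneq a 0.
  have cp : 0 < c by move: ac0; rewrite a00 add0r.
  exists c^-1; first by rewrite invr_gt0.
  by rewrite a00 scale0r add0r scalerA mulVf ?scale1r ?gt_eqF.
have ap : 0 < a by rewrite lt_def a_neq0.
have [xi0|xi0] := eqVneq xi 0.
  have yx : y = x.
    by rewrite -yE -[xi]scale1r sexp_line xi0 !scaler0 addr0 (_ : enorm 0 = 0)
      ?mulr0 ?cos0 ?scale1r//; apply/eqP; rewrite enorm_eq0.
  exists (a + c)^-1; first by rewrite invr_gt0.
  by rewrite yx -scalerDl scalerA mulVf ?scale1r ?gt_eqF.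
have e0 : 0 < enorm xi by rewrite enorm_gt0.
set e := enorm xi in e0.
have epi : e < pi.
  rewrite ltNge; apply/negP => pie.
  have := xiO (pi / e).
  rewrite ler_pdivrMr// mul1r pie divr_ge0 ?pi_ge0 ?(ltW e0)//= => /(_ isT).
  rewrite sexp_line divfK ?gt_eqF// cospi sinpi mul0r scale0r addr0 scaleN1r.
  by move=> /vO; have := vO _ Ox; rewrite dotNr; lra.
have sine0 : 0 < sin e by rewrite sin_gt0_pi// e0.
pose g s := a * sin s - c * sin (e - s).
have gcont : continuous g.
  move=> s; apply: (@continuousB R R^o R (fun s => a * sin s) (fun s => c * sin (e - s))).
    apply: (@continuousM R R (fun=> a) sin); first exact: cst_continuous.
    exact: continuous_sin.
  apply: (@continuousM R R (fun=> c) (fun s => sin (e - s))); first exact: cst_continuous.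
  apply: (@continuous_comp _ _ _ (fun s => e - s) sin); last exact: continuous_sin.
  by apply: (@continuousB R R^o R (fun=> e) id); [exact: cst_continuous|exact: id].
(* At distance s from x, the point of the arc is proportional to
   sin (e - s) x + sin s y. *)
have [s] : exists2 s, s \in `[0, e] & g s = 0.
  apply: IVT => //; [exact: ltW|exact: continuous_subspaceT|].
  rewrite /g sin0 subr0 subrr sin0 !mulr0 subr0 sub0r.
  by rewrite ge_min le_max oppr_le0 !mulr_ge0 ?orbT// ltW.
rewrite in_itv/= => /andP[s0 se] /eqP; rewrite subr_eq0 => /eqP gs.
have Oz := xiO (s / e); rewrite ler_pdivrMr// mul1r se divr_ge0 ?(ltW e0)//= in Oz.
move: (Oz isT) => {}Oz; rewrite sexp_line -/e divfK ?gt_eqF// in Oz.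
set z := _ + _ in Oz.
have ze : (a * sin e) *: z = sin (e - s) *: (a *: x + c *: y).
  rewrite -yE -[in sexp _ xi](scale1r xi) sexp_line mul1r -/e /z.
  rewrite !scalerDr !scalerA addrA -scalerDl.
  have -> : sin (e - s) * c * (sin e / e) = a * sin s * (sin e / e) by rewrite gs; ring.
  rewrite (_ : sin (e - s) * a + sin (e - s) * c * cos e = a * sin e * cos s).
    by congr (_ + _ *: _); ring.
  transitivity (a * sin (e - s) + a * sin s * cos e); first by rewrite gs; ring.
  by rewrite sinB; ring.
have se0 : 0 < sin (e - s).
  rewrite lt_def; apply/andP; split.
    apply: contraTneq (sphere_neq0 (Os _ Oz)) => es0; rewrite negbK.
    by move: ze => /eqP; rewrite es0 scale0r scaler_eq0 gt_eqF//= mulr_gt0.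
  by apply: sin_ge0_pi; rewrite subr_ge0 se/=; lra.
exists (sin (e - s) / (a * sin e)); first by rewrite divr_gt0// mulr_gt0.
rewrite mulrC -scalerA -ze scalerA mulVf ?scale1r//.
by rewrite gt_eqF// mulr_gt0.
Qed.

Definition cone_over Omega : set V :=
  [set w | exists2 a, 0 <= a & exists2 z, Omega z & w = a *: z].

(** Radial projection is continuous near [x], and [Omega] is open in the
    sphere. *)
Lemma cone_over_nbhs Omega x : sopen Omega -> Omega x -> nbhs x (cone_over Omega).
Proof.
move=> [U oU OE] Ox; have [Ux x1] : (U `&` sphere) x by rewrite -OE.
have nx : enorm x != 0 by rewrite enorm_eq0 sphere_neq0.
have fc : {for x, continuous (fun w : V => (enorm w)^-1 *: w)}.
  apply: (@continuousZ R V V (fun w => (enorm w)^-1) id); last exact: id.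
  by apply: (@continuousV R V (@enorm R n)) => //; exact: enorm_continuous.
have nU : nbhs x ((fun w : V => (enorm w)^-1 *: w) @^-1` U).
  by apply: fc; apply: open_nbhs_nbhs; split => //; rewrite enorm1// invr1 scale1r.
have n0 : nbhs x [set w : V | enorm w != 0].
  have : nbhs (enorm x) [set r : R | r != 0].
    by apply: open_nbhs_nbhs; split => //; exact: open_neq.
  by move/enorm_continuous.
near=> w; exists (enorm w); first exact: enorm_ge0.
have w0 : enorm w != 0 by near: w.
exists ((enorm w)^-1 *: w); last by rewrite scalerA mulfV// scale1r.
rewrite OE; split; first by near: w.
by apply: sphere_normalize; rewrite -enorm_eq0.
Unshelve. all: by end_near. Qed.

Lemma cone_over_add Omega v : Omega `<=` sphere -> positive_on Omega v ->
  (forall x y, Omega x -> Omega y -> geodesically_joined Omega x y) ->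
  forall p q, cone_over Omega p -> cone_over Omega q -> cone_over Omega (p + q).
Proof.
move=> Os vO Oc p q [a a0 [x Ox ->]] [c c0 [y Oy ->]].
have [ac|ac] := ltP 0 (a + c).
  have [r r0 Or] := scaled_combination_mem Os vO (Oc x y Ox Oy) Ox Oy a0 c0 ac.
  exists r^-1; first by rewrite invr_ge0 ltW.
  by exists (r *: (a *: x + c *: y)) => //; rewrite scalerA mulVf ?scale1r ?gt_eqF.
have -> : a = 0 by lra.
have -> : c = 0 by lra.
by exists 0 => //; exists x => //; rewrite !scale0r addr0.
Qed.

Lemma closure_add (C : set V) : (forall p q, C p -> C q -> C (p + q)) ->
  forall p q, closure C p -> closure C q -> closure C (p + q).
Proof.
move=> CD p q Cp Cq B /(@add_continuous V (p, q))[[B1 B2] /= [n1 n2] BB].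
have [u [Cu B1u]] := Cp _ n1; have [w [Cw B2w]] := Cq _ n2.
by exists (u + w); split; [exact: CD|exact: (BB (u, w))].
Qed.

Lemma closure_scale (C : set V) a : (forall p, C p -> C (a *: p)) ->
  forall p, closure C p -> closure C (a *: p).
Proof.
move=> CZ p Cp B nB.
have fc : {for p, continuous (fun u : V => a *: u)}.
  by apply: (@continuousZ R V V (fun=> a) id); [exact: cst_continuous|exact: id].
have [u [Cu Bu]] := Cp _ (fc _ nB).
by exists (a *: u); split => //; exact: CZ.
Qed.

(** As [b] may lie on the boundary of the cone, compactness is needed: for each
    [eps > 0] the point [b - eps *: x] is outside the closed cone, so some
    unit vector [v] that is nonnegative on [Omega] satisfies
    [dot v b <= eps].  A minimizer of [dot b] among these vectors then satisfies
    [dot v b <= 0], and openness of the cone makes it positive on [Omega]. *)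
Lemma exists_support Omega x b : Omega `<=` sphere -> sopen Omega -> sconvex Omega ->
  Omega x -> sphere b -> ~ Omega b ->
  exists v, [/\ v != 0, positive_on Omega v & dot v b <= 0].
Proof.
move=> Os Oo [[H [P hP PH] OH] Oc] Ox b1 Ob.
have [v0 [_ _ v0O]] := half_space_positive hP PH OH (ex_intro _ x Ox).
have CD := cone_over_add Os v0O Oc.
have CZ a p : 0 <= a -> cone_over Omega p -> cone_over Omega (a *: p).
  move=> a0 [c c0 [z Oz ->]]; exists (a * c); first exact: mulr_ge0.
  by exists z => //; rewrite scalerA.
have C0 : cone_over Omega 0 by exists 0 => //; exists x => //; rewrite scale0r.
have CO w : Omega w -> cone_over Omega w.
  by move=> Ow; exists 1 => //; exists w => //; rewrite scale1r.
have bC : ~ cone_over Omega b.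
  move=> [a a0 [z Oz bE]]; apply: Ob; suff a1 : a = 1 by rewrite bE a1 scale1r.
  move: b1; rewrite /sphere /= bE dotZl dotZr (Os _ Oz) mulr1 => aa.
  by apply/eqP; rewrite -(@eqrXn2 _ 2)// expr1n expr2 aa.
have beps eps : 0 < eps -> ~ closure (cone_over Omega) (b - eps *: x).
  move=> e0 /(_ [set k | cone_over Omega (x + eps^-1 *: (b - eps *: x - k))]).
  (* Otherwise b is the sum of a point k of the cone near b - eps x and of
     eps times a point of the cone near x. *)
  case=> [|k [Ck Cxk]].
    have fc : continuous (fun k : V => x + eps^-1 *: (b - eps *: x - k)).
      move=> k; apply: (@continuousD R V V (fun=> x)
        (fun k => eps^-1 *: (b - eps *: x - k))); first exact: cst_continuous.
      apply: (@continuousZ R V V (fun=> eps^-1) (fun k => b - eps *: x - k)).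
        exact: cst_continuous.
      by apply: (@continuousB R V V (fun=> b - eps *: x) id);
        [exact: cst_continuous|exact: id].
    by apply: fc; rewrite subrr scaler0 addr0; exact: cone_over_nbhs.
  apply: bC; have -> : b = k + eps *: (x + eps^-1 *: (b - eps *: x - k)).
    rewrite scalerDr scalerA mulfV ?gt_eqF// scale1r.
    have -> : eps *: x + (b - eps *: x - k) = b - k by rewrite addrC addrAC subrK.
    by rewrite addrC subrK.
  by apply: CD => //; apply: CZ => //; exact: ltW.
pose K := [set v : V | dot v v = 1 /\ forall w, Omega w -> 0 <= dot v w].
have Keps eps : 0 < eps -> exists2 v, K v & dot v b <= eps.
  move=> e0; have cl0 := @subset_closure _ (cone_over Omega) 0 C0.
  have clZ a p : 0 <= a ->
      closure (cone_over Omega) p -> closure (cone_over Omega) (a *: p).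
    by move=> a0; apply: closure_scale => q; exact: CZ.
  have [v [vC vb]] := cone_separation (@closed_closure _ (cone_over Omega)) cl0
    (closure_add CD) clZ (beps _ e0).
  have vn0 : v != 0 by apply: contraTneq vb => ->; rewrite dot0l ltxx.
  have ev : 0 < enorm v by rewrite enorm_gt0.
  exists ((enorm v)^-1 *: v); first split.
  - exact: sphere_normalize.
  - move=> w Ow; rewrite dotZl; apply: mulr_ge0; first by rewrite invr_ge0 ltW.
    by apply: vC; apply: subset_closure; exact: CO.
  - have nv1 := sphere_normalize vn0.
    have /andP[_ vx1] := dot_sphere_le1 nv1 (Os _ Ox).
    have : dot ((enorm v)^-1 *: v) (b - eps *: x) < 0.
      by rewrite dotZl pmulr_rlt0// invr_gt0.
    rewrite dotBr dotZr => h.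
    have : eps * dot ((enorm v)^-1 *: v) x <= eps * 1 by rewrite ler_pM2l.
    lra.
have cK : compact K.
  apply: (@enorm_bounded_compact _ _ _ 1); last by move=> v [v1 _]; rewrite enorm1.
  have -> : K = sphere `&` \bigcap_(w in Omega) [set v | 0 <= dot v w] by [].
  apply: closedI; first exact: sphere_closed.
  by apply: closed_bigI => w _; exact: closed_dot_ge0.
have [v1 Kv1 _] := Keps 1 ltr01.
have [v] := @EVT_min_rV R _ (dot b) K (ex_intro _ _ Kv1) cK
  (continuous_subspaceT (@dot_continuous _ _ b)).
rewrite inE => -[vv vO] vmin; exists v; split.
- by apply: sphere_neq0.
- move=> w Ow; rewrite lt_def vO// andbT; apply/eqP => vw.
  (* If dot v w = 0, then w - t v would be in the cone for small t > 0, but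
     dot v (w - t v) = - t. *)
  have fc : continuous (fun t : R => w - t *: v).
    move=> t; apply: (@continuousB R V R (fun=> w) (fun t => t *: v)).
      exact: cst_continuous.
    by apply: (@continuousZ R V R id (fun=> v)); [exact: id|exact: cst_continuous].
  have : nbhs (0 : R) ((fun t : R => w - t *: v) @^-1` (cone_over Omega)).
    by apply: fc; rewrite scale0r subr0; exact: cone_over_nbhs.
  move=> /nbhs_ballP[d /= d0 /(_ (d / 2))].
  rewrite /ball/= sub0r normrN gtr0_norm ?divr_gt0// => /(_ _)[|a a0 [z Oz wE]].
    by rewrite ltr_pdivrMr// ltr_pMr// ltr1n.
  have := mulr_ge0 a0 (vO _ Oz); rewrite -dotZr -wE dotBr dotZr vw vv.
  have : 0 < d / 2 by rewrite divr_gt0.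
  lra.
- rewrite leNgt; apply/negP => vb.
  have vb2 : 0 < dot v b / 2 by rewrite divr_gt0.
  have [w Kw wb] := Keps _ vb2.
  have := vmin w; rewrite inE => /(_ Kw); rewrite !(dotC b); lra.
Qed.

End Convexity.

(** * The two expressions of the Finsler metric *)

Section Terms.
Context {R : realType} {n : nat}.
Local Notation V := 'rV[R]_n.+1.
Implicit Types (x y z v w xi b : V) (a t : R) (Omega P H : set V).

Lemma is_first_hit_uniq x xi (A : set V) z z' :
  is_first_hit x xi A z -> is_first_hit x xi A z' -> z = z'.
Proof.
move=> [t [t0 zE Az nA]] [t' [t'0 zE' Az' nA']].
have [tt|tt|tt] := ltgtP t t'.
- by exfalso; apply: (nA' t); [rewrite t0|rewrite -zE].
- by exfalso; apply: (nA t'); [rewrite t'0|rewrite -zE'].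
- by rewrite zE zE' tt.
Qed.

Lemma first_hitE x xi (A : set V) z : is_first_hit x xi A z -> first_hit x xi A = z.
Proof.
move=> zhit; apply: (@is_first_hit_uniq x xi A) => //.
by apply: (@getPex _ (is_first_hit x xi A)); exists z.
Qed.

Lemma sdist_sexp x xi t : sphere x -> tangent x xi -> 0 <= t * enorm xi <= pi ->
  sdist x (sexp x (t *: xi)) = t * enorm xi.
Proof.
move=> x1 xxi tpi; rewrite /sdist sexp_line dotDr !dotZr xxi mulr0 addr0.
by rewrite x1 mulr1 cosK// in_itv.
Qed.

(** Excludes hits before the one at distance [r]: the zeros of a nonzero sinusoid
    are at least pi apart. *)
Lemma sinusoid_zeros a c r s : cos r * a + sin r * c = 0 -> cos s * a + sin s * c = 0 ->
  a * sin (r - s) = 0.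
Proof.
move=> hr hs; rewrite sinB mulrBr.
have -> : a * (sin r * cos s) = - sin r * (sin s * c).
  by rewrite -[sin s * c](addKr (cos s * a)) hs addr0; ring.
have -> : a * (cos r * sin s) = - sin s * (sin r * c).
  by rewrite -[sin r * c](addKr (cos r * a)) hr addr0; ring.
by ring.
Qed.

(** The zero of [cos r * dot v x + sin r * (dot v xi / enorm xi)] in (0, pi) has
    cotangent [- dot v xi / (enorm xi * dot v x)]. *)
Lemma first_hit_great_sphere x xi v : sphere x -> tangent x xi -> xi != 0 ->
  0 < dot v x ->
  let r := sdist x (first_hit x xi (great_sphere v)) in
  cos r / sin r * enorm xi = - (dot v xi / dot v x).
Proof.
move=> x1 xxi xi0 vx /=; pose e := enorm xi; have e0 : 0 < e by rewrite enorm_gt0.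
pose q := dot v xi / e / dot v x.
(* cot (atan q + pi / 2) = - q. *)
pose r := atan q + pi / 2.
have [/andP[tn tp] tE] := atan_def q.
have cq : 0 < cos (atan q) by apply: cos_gt0_pihalf; rewrite tn.
have r0 : 0 < r by rewrite /r; lra.
have rpi : r < pi by rewrite /r; lra.
have cr : cos r = - sin (atan q) by rewrite cosDpihalf.
have sr : sin r = cos (atan q) by rewrite sinDpihalf.
have sq : sin (atan q) = q * cos (atan q).
  by move/(congr1 (fun u => u * cos (atan q))): tE; rewrite /tan divfK// gt_eqF.
have rE : r / e * e = r by rewrite divfK// gt_eqF.
have hr : cos r * dot v x + sin r * (dot v xi / e) = 0.
  rewrite cr sr sq /q; field.
  by rewrite !gt_eqF.
have dotE t : dot v (sexp x (t *: xi)) =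
    cos (t * e) * dot v x + sin (t * e) * (dot v xi / e).
  by rewrite sexp_line dotDr !dotZr mulrAC mulrA.
have hit : is_first_hit x xi (great_sphere v) (sexp x ((r / e) *: xi)).
  exists (r / e); split => //; first exact: divr_gt0.
    split; last by rewrite dotE rE.
    by apply: sexp_sphere => //; rewrite /tangent /= dotZr xxi mulr0.
  move=> s /andP[s0 sr'] [_]; rewrite dotE => hs.
  have se : s * e < r by rewrite -ltr_pdivlMr.
  have se0 : 0 < s * e by rewrite mulr_gt0.
  have /eqP := sinusoid_zeros hr hs; rewrite mulf_eq0 gt_eqF//= gt_eqF//.
  by apply: sin_gt0_pi; apply/andP; split; lra.
rewrite (first_hitE hit) sdist_sexp ?rE; first last.
- by apply/andP; split; exact: ltW.
- by [].
- by [].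
rewrite -/e cr sr sq /q; field.
by rewrite !gt_eqF.
Qed.

(** The point of the great sphere nearest to [y] is the normalized projection
    of [y] on the orthogonal of [v]; when [y = v] this projection is 0 and every
    point is at distance pi / 2. *)
Lemma sdist_set_great_sphere v y : dot v v = 1 -> sphere y -> 0 <= dot v y ->
  great_sphere v !=set0 -> sdist_set y (great_sphere v) = asin (dot v y).
Proof.
move=> v1 y1 s0 [z0 [z01 vz0]]; set s := dot v y.
have /andP[sm1 s1] : -1 <= s <= 1 by exact: dot_sphere_le1.
have [/andP[_ asp] ase] : - (pi / 2) <= asin s <= pi / 2 /\ sin (asin s) = s.
  by apply: asin_def; rewrite sm1.
have as0 : 0 <= asin s.
  rewrite leNgt; apply/negP => as0.
  have : 0 < sin (- asin s).
    apply: sin_gt0_pihalf; rewrite oppr_gt0 as0/= ltrNl; apply: asin_gtNpi2.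
    by rewrite s1 andbT; rewrite /s; lra.
  by rewrite sinN ase oppr_gt0 ltNge s0.
have cas : cos (asin s) = Num.sqrt (1 - s ^+ 2) by apply: cos_asin; rewrite sm1.
have s2 : 0 <= 1 - s ^+ 2 by nra.
have perp z : great_sphere v z -> (dot y z) ^+ 2 <= 1 - s ^+ 2.
  move=> [z1 vz]; have := cauchy_schwarz (y - s *: v) z.
  rewrite z1 mulr1 !(dotBl, dotBr, dotZl, dotZr) vz (dotC y v) v1 y1 -/s.
  by rewrite mulr0 subr0 => h; apply: le_trans h _; rewrite le_eqVlt;
    apply/orP; left; apply/eqP; ring.
have [z zP yz] : exists2 z, great_sphere v z & dot y z = cos (asin s).
  rewrite cas; have [s1'|s1'] := eqVneq (1 - s ^+ 2) 0.
    exists z0; first by split.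
    have := perp z0 (conj z01 vz0).
    rewrite s1' sqrtr0 => h; apply/eqP; rewrite -sqrf_eq0 eq_le h; exact: sqr_ge0.
  have Np : 0 < 1 - s ^+ 2 by rewrite lt_def s1'.
  have Nq : Num.sqrt (1 - s ^+ 2) != 0 by rewrite sqrtr_eq0 -ltNge.
  have Nsq : Num.sqrt (1 - s ^+ 2) ^+ 2 = 1 - s ^+ 2 by rewrite sqr_sqrtr.
  exists ((Num.sqrt (1 - s ^+ 2))^-1 *: (y - s *: v)); first split.
  - rewrite /sphere /= !(dotBl, dotBr, dotZl, dotZr) v1 y1 (dotC y v) -/s.
    transitivity ((Num.sqrt (1 - s ^+ 2))^-1 ^+ 2 * Num.sqrt (1 - s ^+ 2) ^+ 2).
      by rewrite Nsq; ring.
    by rewrite -exprMn mulVf ?expr1n.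
  - by rewrite dotZr dotBr dotZr v1 mulr1 subrr mulr0.
  - rewrite dotZr dotBr dotZr y1 (dotC y v) -/s -expr2 -[X in _ * X]Nsq; field.
    by [].
have lb : lbound [set sdist y z | z in great_sphere v] (asin s).
  move=> _ [w wP <-]; rewrite /sdist leNgt; apply/negP => lt.
  have wd : -1 <= dot y w <= 1 by apply: dot_sphere_le1 => //; exact: wP.1.
  have [/andP[ac0 acpi] acE] := acos_def wd.
  have : cos (asin s) < cos (acos (dot y w)).
    rewrite ltr_cos// in_itv/= ?ac0 ?acpi ?as0//=; lra.
  rewrite acE cas ltNge => /negP; apply.
  apply: le_trans (ler_norm _) _.
  by rewrite -sqrtr_sqr ler_sqrt// perp.
apply/eqP; rewrite eq_le; apply/andP; split.
  apply: ge_inf; first by exists (asin s).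
  exists z => //; rewrite /sdist yz cosK// in_itv/= as0/=; lra.
by apply: lb_le_inf => //; exists (sdist y z0); exists z0 => //; split.
Qed.

(** Test both gradients on their difference, which is tangent. *)
Lemma is_gradient_uniq (f : V -> R) x g g' :
  is_gradient f x g -> is_gradient f x g' -> g = g'.
Proof.
move=> [tg hg] [tg' hg'].
have tt : tangent x (g - g') by rewrite /tangent /= dotBr tg tg' subrr.
have e : dot g (g - g') = dot g' (g - g').
  by have [_ <-] := hg _ tt; have [_ <-] := hg' _ tt.
by apply/eqP; rewrite -subr_eq0 -dot_eq0 dotBl e subrr.
Qed.

Lemma gradientE (f : V -> R) x g : is_gradient f x g -> gradient f x = g.
Proof.
move=> hg; apply: (@is_gradient_uniq f x) => //.
by apply: (@getPex _ (is_gradient f x)); exists g.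
Qed.

(** With [s = dot v x], the distance to the hyperplane is [asin s] near [x], its
    gradient is [(v - s *: x) / sqrt (1 - s ^+ 2)], of norm 1, and
    [cos (asin s) / sin (asin s) = sqrt (1 - s ^+ 2) / s].  The value pi / 2 is
    reached only for [x = v], where [dot v xi = 0] too. *)
Lemma eta_great_sphere x xi v : dot v v = 1 -> sphere x -> tangent x xi ->
  0 < dot v x -> great_sphere v !=set0 ->
  let r := sdist_set x (great_sphere v) in
  (if r == pi / 2 then 0 else cos r / sin r * dot (eta (great_sphere v) x) xi) =
  - (dot v xi / dot v x).
Proof.
move=> v1 x1 xxi vx P0 /=; rewrite sdist_set_great_sphere//; last exact: ltW.
set s := dot v x in vx *.
have /andP[sm1 s1] : -1 <= s <= 1 by exact: dot_sphere_le1.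
have [_ ase] : - (pi / 2) <= asin s <= pi / 2 /\ sin (asin s) = s.
  by apply: asin_def; rewrite sm1.
case: eqP => asp.
  have sE : s = 1 by rewrite -ase asp sin_pihalf.
  suff -> : v = x by rewrite xxi mul0r oppr0.
  apply/eqP; rewrite -subr_eq0 -dot_eq0 !(dotBl, dotBr) v1 x1 (dotC x v) -/s sE.
  by apply/eqP; ring.
have sl1 : s < 1.
  rewrite lt_neqAle s1 andbT; apply/eqP => sE; apply: asp.
  have pin : pi / 2 \in `[- (pi / 2), pi / 2 : R].
    by rewrite in_itv/= lexx andbT; have := pi_gt0 R; lra.
  by have := sinK pin; rewrite sin_pihalf sE.
have cas : cos (asin s) = Num.sqrt (1 - s ^+ 2) by apply: cos_asin; rewrite sm1.
have Np : 0 < 1 - s ^+ 2 by nra.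
set N := Num.sqrt _ in cas.
have N0 : 0 < N by rewrite sqrtr_gt0.
have N2 : N ^+ 2 = 1 - s ^+ 2 by rewrite sqr_sqrtr// ltW.
pose g := N^-1 *: (v - s *: x).
have gg : is_gradient (sdist_set^~ (great_sphere v)) x g.
  split; first by rewrite /tangent /= dotZr dotBr dotZr x1 (dotC x v) mulr1 subrr mulr0.
  move=> h xh; pose f (t : R) := dot v (sexp x (t *: h)).
  have fd : is_derive (0 : R) (1 : R) f (dot v h).
    have := is_derive_dot v (is_derive_sexp x h 0).
    by rewrite mul0r sin0 mulr0 oppr0 cos0 scale0r add0r scale1r.
  have f0 : f 0 = s by rewrite /f sexp_line mul0r sin0 cos0 mul0r scale0r addr0 scale1r.
  have dE : dot g h = N^-1 * dot v h.
    by rewrite dotZl dotBl dotZl xh mulr0 subr0.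
  have comp : is_derive (0 : R) (1 : R) (asin \o f) (N^-1 * dot v h).
    apply: (@is_derive1_comp R asin f) => //; rewrite f0.
    by apply: is_derive1_asin; rewrite sl1 andbT; lra.
  rewrite dE; apply: near_eq_is_derive comp.
  have fpos : nbhs (0 : R) (f @^-1` [set r | 0 < r]).
    have : {for 0, continuous f}.
      by apply: differentiable_continuous; apply/derivable1_diffP; case: fd.
    by apply; rewrite f0; apply: open_nbhs_nbhs; split => //; exact: open_gt.
  near=> t; rewrite /= -sdist_set_great_sphere//.
    by apply: sexp_sphere => //; rewrite /tangent /= dotZr xh mulr0.
  by apply: ltW; near: t.
have eg : enorm g = 1.
  apply: enorm1; rewrite !(dotBl, dotBr, dotZl, dotZr) v1 x1 (dotC x v) -/s.
  transitivity (N^-1 ^+ 2 * N ^+ 2); first by rewrite N2; ring.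
  by rewrite -exprMn mulVf ?expr1n// gt_eqF.
rewrite /eta (gradientE gg) eg invr1 scale1r dotNl dotZl dotBl dotZl xxi mulr0 subr0.
rewrite ase cas; field.
by rewrite !gt_eqF.
Unshelve. all: by end_near. Qed.

End Terms.

(** * Geodesics in Omega and the Funk metric *)

Section Chords.
Context {R : realType} {n : nat}.
Local Notation V := 'rV[R]_n.+1.
Implicit Types (x y z v w u xi b : V) (a t d l : R).
Variable Omega : set V.
Hypothesis Os : Omega `<=` sphere.
Hypothesis Oo : sopen Omega.
Hypothesis Oc : sconvex Omega.

(** The two suprema are over the same set of values. *)
Lemma finsler_hit_eta x xi : Omega x -> tangent x xi ->
  finsler_hit Omega x xi = finsler_eta Omega x xi.
Proof.
move=> Ox xxi; rewrite /finsler_hit /finsler_eta; case: eqP => // /eqP xi0.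
have x1 := Os Ox.
have O0 : Omega !=set0 by exists x.
have terms P : supporting_hyperplane Omega P ->
    (let r := sdist x (first_hit x xi P) in (cos r / sin r * enorm xi)%:E) =
    (let r := sdist_set x P in if r == pi / 2 then 0
                  else cos r / sin r * dot (eta P x) xi)%:E.
  move=> sP; have [v [v1 PE vO]] := supporting_positive O0 sP.
  have [_ [z [_ Pz]] _] := sP.
  have P0 : great_sphere v !=set0 by exists z; rewrite -PE.
  rewrite PE; congr EFin.
  rewrite (first_hit_great_sphere x1 xxi xi0 (vO _ Ox)).
  exact: (esym (eta_great_sphere v1 x1 xxi (vO _ Ox) P0)).
by congr ereal_sup; apply/seteqP; split => _ [P sP <-]; exists P => //;
  [exact: esym (terms P sP)|exact: terms].
Qed.

Lemma finsler_hit_ge v x xi : positive_on Omega v ->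
  supporting_hyperplane Omega (great_sphere v) -> Omega x -> tangent x xi ->
  ((- (dot v xi / dot v x))%:E <= finsler_hit Omega x xi)%E.
Proof.
move=> vO sP Ox xxi; rewrite /finsler_hit; case: eqP => [->|/eqP xi0].
  by rewrite dot0r mul0r oppr0.
apply: ereal_sup_ubound; exists (great_sphere v) => //.
by rewrite (first_hit_great_sphere (Os Ox) xxi xi0 (vO _ Ox)).
Qed.

Lemma finsler_hit_le x xi (M : R) : Omega x -> tangent x xi -> xi != 0 ->
  (forall v, positive_on Omega v -> - (dot v xi / dot v x) <= M) ->
  (finsler_hit Omega x xi <= M%:E)%E.
Proof.
move=> Ox xxi xi0 h; rewrite /finsler_hit (negPf xi0).
apply/ereal_supP => _ [P sP <-].
have [v [v1 -> vO]] := supporting_positive (ex_intro _ x Ox) sP.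
by rewrite (first_hit_great_sphere (Os Ox) xxi xi0 (vO _ Ox)) lee_fin h.
Qed.

Lemma sconvex_positive x : Omega x -> exists2 v, v != 0 & positive_on Omega v.
Proof.
move=> Ox; have [[H [P hP PH] OH] _] := Oc.
have [v [v0 _ vO]] := half_space_positive hP PH OH (ex_intro _ x Ox).
by exists v.
Qed.

Lemma sphere_combination_mem x y z a c : Omega x -> Omega y -> sphere z ->
  0 <= a -> 0 <= c -> z = a *: x + c *: y -> Omega z.
Proof.
move=> Ox Oy z1 a0 c0 zE; have [v0 _ v0O] := sconvex_positive Ox.
have ac : 0 < a + c.
  rewrite lt_def addr_ge0// andbT; apply: contraTneq (sphere_neq0 z1) => ac.
  have a_0 : a = 0 by lra.
  have c_0 : c = 0 by lra.
  by rewrite zE a_0 c_0 !scale0r addr0 eqxx.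
have [r r0 Or] := scaled_combination_mem Os v0O (Oc.2 _ _ Ox Oy) Ox Oy a0 c0 ac.
move: (Os Or) (Or); rewrite -zE /sphere /= dotZl dotZr z1 mulr1 => rr.
suff -> : r = 1 by rewrite scale1r.
by apply/eqP; rewrite -(@eqrXn2 _ 2)// ?ltW// expr1n expr2 rr.
Qed.

Definition great_arc x u t := cos t *: x + sin t *: u.

Lemma great_arcE x u t : dot u u = 1 -> great_arc x u t = sexp x (t *: u).
Proof. by move=> u1; rewrite sexp_line enorm1// mulr1 divr1. Qed.

Lemma great_arc0 x u : great_arc x u 0 = x.
Proof. by rewrite /great_arc cos0 sin0 scale1r scale0r addr0. Qed.

(** [l] is the supremum of the times up to which the arc stays in [Omega].  It is
    less than pi because a form that is positive on [Omega] is nonnegative on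
    its closure and negative at [- x], the point reached at time pi. *)
Lemma great_arc_exit x u : Omega x -> tangent x u -> dot u u = 1 ->
  exists l, [/\ 0 < l < pi, forall s, 0 <= s < l -> Omega (great_arc x u s),
    ~ Omega (great_arc x u l) & sboundary Omega (great_arc x u l)].
Proof.
move=> Ox xu u1; have x1 := Os Ox.
have [v v0 vO] := sconvex_positive Ox.
have arc1 t : sphere (great_arc x u t).
  by rewrite great_arcE//; apply: sexp_sphere => //; rewrite /tangent /= dotZr xu mulr0.
have ac : continuous (great_arc x u).
  rewrite (_ : great_arc x u = fun t => sexp x (t *: u)).
    exact: sexp_path_continuous.
  by apply/funext => t; rewrite great_arcE.
have arcpi : great_arc x u pi = - x.
  by rewrite /great_arc cospi sinpi scale0r addr0 scaleN1r.
pose S := [set t | 0 <= t /\ forall s, 0 <= s <= t -> Omega (great_arc x u s)].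
have S0 : S 0.
  split => // s /andP[s0 s0'].
  by have -> : s = 0 by [apply/eqP; rewrite eq_le s0 s0']; rewrite great_arc0.
have Spi t : S t -> t <= pi.
  move=> [t0 St]; rewrite leNgt; apply/negP => tpi.
  have /vO : Omega (great_arc x u pi) by apply: St; rewrite pi_ge0 ltW.
  by rewrite arcpi dotNr; have := vO _ Ox; lra.
have hS : has_sup S by split; [exists 0|exists pi].
pose l := sup S.
have l0 : 0 <= l by apply: sup_upper_bound.
have lpi : l <= pi by apply: ge_sup => //; exists 0.
have Ol s : 0 <= s < l -> Omega (great_arc x u s).
  move=> /andP[s0 sl]; have ls : 0 < l - s by lra.
  have [t [t0 St] lt] := sup_adherent ls hS.
  by apply: St; rewrite s0/= ltW//; move: lt; rewrite subKr.
have nOl : ~ Omega (great_arc x u l).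
  move=> Ol'; have [U oU OE] := Oo.
  have nU : nbhs l (great_arc x u @^-1` U).
    by apply: ac; apply: open_nbhs_nbhs; split => //; move: Ol'; rewrite OE => -[].
  have [e /= e0 eU] := (nbhs_ballP _ _).1 nU.
  have : S (l + e / 2).
    split; first by rewrite addr_ge0// divr_ge0// ltW.
    move=> s /andP[s0 sl]; have [sl'|sl'] := ltP s l; first by apply: Ol; rewrite s0.
    rewrite OE; split => //; apply: eU; rewrite /ball /= distrC ger0_norm ?subr_ge0//.
    lra.
  by move/(sup_upper_bound hS); rewrite -/l gerDl leNgt divr_gt0.
have l_gt0 : 0 < l.
  by rewrite lt_def l0 andbT; apply/eqP => l00; apply: nOl; rewrite l00 great_arc0.
have cl : closure Omega (great_arc x u l).
  move=> B /ac /nbhs_ballP[e /= e0 eB].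
  exists (great_arc x u (l - Num.min e l / 2)); split.
    by apply: Ol; apply/andP; case: (leP e l) => el; split; lra.
  apply: eB; rewrite /ball /= opprB addrC subrK.
  by case: (leP e l) => el; rewrite ger0_norm; lra.
have bd : sboundary Omega (great_arc x u l).
  by split => //; apply: subset_closure.
exists l; split => //; rewrite l_gt0/= lt_neqAle lpi andbT; apply/eqP => lE.
have : closure [set z | 0 <= dot z v] (great_arc x u l).
  by apply: closure_subset cl => z /vO; rewrite /= dotC => /ltW.
rewrite -(closure_id _).1; last exact: closed_dot_ge0.
by rewrite /= lE arcpi dotC dotNr; have := vO _ Ox; lra.
Qed.

Lemma sboundary_not_mem z : sboundary Omega z -> ~ Omega z.
Proof.
move=> [_ cz] Oz; have [U oU OE] := Oo.
have nU : nbhs z U by apply: open_nbhs_nbhs; split => //; move: Oz; rewrite OE => -[].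
by have [w [[w1 nOw] Uw]] := cz _ nU; apply: nOw; rewrite OE.
Qed.

Lemma sboundary_dot_ge0 z v : positive_on Omega v -> sboundary Omega z -> 0 <= dot v z.
Proof.
move=> vO [cl _]; have : closure [set z | 0 <= dot z v] z.
  by apply: closure_subset cl => w /vO; rewrite /= dotC => /ltW.
by rewrite -(closure_id _).1; [rewrite /= dotC|exact: closed_dot_ge0].
Qed.

Lemma exists_supporting_at x b : Omega x -> sboundary Omega b ->
  exists v, [/\ positive_on Omega v, supporting_hyperplane Omega (great_sphere v)
    & dot v b = 0].
Proof.
move=> Ox bO; have b1 : sphere b.
  by apply: sphere_closed; exact: closure_subset Os _ bO.1.
have [v [v0 vO vb]] := exists_support Os Oo Oc Ox b1 (sboundary_not_mem bO).
have vb0 : dot v b = 0 by apply/eqP; rewrite eq_le vb; exact: sboundary_dot_ge0.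
exists v; split => //; apply: (positive_supporting Os _ Ox) bO vb0 => //.
by move=> y Oy; exact: Oc.2.
Qed.

(** Puts the chord through [x] and [y] in polar form: [u] is the direction of [y]
    seen from [x], and the exit time [l] comes after [d] because the points of
    the arc from [x] to [y] are nonnegative combinations of its ends. *)
Lemma funk_chord x y : Omega x -> Omega y -> x != y ->
  exists u d l, [/\ tangent x u, dot u u = 1, 0 < d < l, y = great_arc x u d &
    [/\ l < pi, forall s, 0 <= s < l -> Omega (great_arc x u s),
       sboundary Omega (great_arc x u l) & funk Omega x y = ln (sin l / sin (l - d))]].
Proof.
move=> Ox Oy xy; have x1 := Os Ox; have y1 := Os Oy.
have [v0 _ v0O] := sconvex_positive Ox.
pose c := dot x y; pose w := y - c *: x.
have xw : tangent x w by rewrite /tangent /= dotBr dotZr x1 mulr1 subrr.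
have ww : dot w w = 1 - c ^+ 2.
  by rewrite !(dotBl, dotBr, dotZl, dotZr) x1 y1 (dotC y x) -/c; ring.
have cb : -1 <= c <= 1 by exact: dot_sphere_le1.
have [/andP[d0 dpi] cd] := acos_def cb; set d := acos c in d0 dpi cd.
have w0 : w != 0.
  apply/eqP => /subr0_eq yE; have /eqP : c ^+ 2 = 1.
    by move: y1; rewrite /sphere /= yE dotZl dotZr x1 mulr1 expr2.
  rewrite sqrf_eq1 => /orP[] /eqP cE; move: yE; rewrite cE ?scale1r ?scaleN1r.
    by move=> yE; rewrite yE eqxx in xy.
  by move=> yE; have := v0O _ Oy; have := v0O _ Ox; rewrite yE dotNr; lra.
pose e := enorm w; have e0 : 0 < e by rewrite enorm_gt0.
have ed : e = sin d by rewrite sin_acos// /e /enorm ww.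
have d_gt0 : 0 < d.
  by rewrite lt_def d0 andbT; apply: contraTneq e0 => dE; rewrite ed dE sin0 ltxx.
have d_ltpi : d < pi.
  by rewrite lt_neqAle dpi andbT; apply: contraTneq e0 => dE; rewrite ed dE sinpi ltxx.
pose u := e^-1 *: w.
have xu : tangent x u by rewrite /tangent /= dotZr xw mulr0.
have u1 : dot u u = 1 by exact: sphere_normalize.
have wE : w = e *: u by rewrite scalerA mulfV ?scale1r ?gt_eqF.
have yE : y = great_arc x u d by rewrite /great_arc -ed -wE cd addrC subrK.
clearbody u.
have [l [/andP[l0 lpi] Ol nOl bl]] := great_arc_exit Ox xu u1.
have l1 : sphere (great_arc x u l).
  by apply: sphere_closed; exact: closure_subset Os _ bl.1.
have dl : d < l.
  rewrite ltNge; apply/negP => ld; apply: nOl.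
  apply: (@sphere_combination_mem x y _ (sin (d - l) / sin d) (sin l / sin d)) => //.
  - by rewrite divr_ge0 -?ed ?(ltW e0)//; apply: sin_ge0_pi; apply/andP; split; lra.
  - by rewrite divr_ge0 -?ed ?(ltW e0)//; apply: sin_ge0_pi; apply/andP; split; lra.
  - rewrite yE /great_arc scalerDr !scalerA addrA -scalerDl sinB.
    by congr (_ *: _ + _ *: _); rewrite -ed; field; rewrite gt_eqF.
exists u, d, l; split => //; first by rewrite d_gt0.
split => //; rewrite /funk (negPf xy) /boundary_hit -/c -/w.
have hit : is_first_hit x w (sboundary Omega) (great_arc x u l).
  exists (l / e); split => //; first exact: divr_gt0.
    by rewrite wE scalerA divfK ?gt_eqF// -great_arcE.
  move=> s /andP[s0 sl]; rewrite wE scalerA -great_arcE//.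
  move=> /sboundary_not_mem; apply; apply: Ol.
  by rewrite mulr_ge0 ?ltW//= -ltr_pdivlMr.
rewrite (first_hitE hit); congr (ln (sin _ / sin _)).
  rewrite great_arcE// sdist_sexp ?enorm1// mulr1//.
  by apply/andP; split; exact: ltW.
rewrite /sdist {1}yE /great_arc !(dotDl, dotDr, dotZl, dotZr) u1 x1 (dotC u) xu.
rewrite (_ : _ + _ = cos (l - d)); last by rewrite cosB; ring.
by rewrite cosK// in_itv/=; apply/andP; split; lra.
Qed.

End Chords.

(** * Minorizing an integral by a primitive *)

Section Integration.
Context {R : realType}.
Local Notation mu := (@lebesgue_measure R).
Implicit Types (a b c d t : R) (p k : R -> \bar R) (G g : R -> R).

(** Monotonicity without measurability: the integral of a nonnegative function
    is the supremum of the integrals of the simple functions below it.  This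
    spares the study of the measurability of the Finsler metric along a
    curve. *)
Lemma le_integral_pointwise (D : set R) (f h : R -> \bar R) :
  (forall t, D t -> (f t <= h t)%E) ->
  (\int[mu]_(t in D) f t <= \int[mu]_(t in D) h t)%E.
Proof.
have mono (f1 f2 : R -> \bar R) : (forall t, D t -> (0 <= f1 t)%E) ->
    (forall t, D t -> (f1 t <= f2 t)%E) ->
    (\int[mu]_(t in D) f1 t <= \int[mu]_(t in D) f2 t)%E.
  move=> f10 f12.
  have f20 t : D t -> (0 <= f2 t)%E by move=> Dt; apply: le_trans (f12 _ Dt); exact: f10.
  rewrite !ge0_integralE//; apply: ereal_sup_le => _ [h0 hf <-]; exists h0 => //= t.
  apply: le_trans (hf t) _; rewrite /patch; case: ifPn => // /set_mem Dt; exact: f12.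
move=> fh; rewrite [leLHS]integralE [leRHS]integralE; apply: leeB.
  apply: mono => t Dt; first exact: funepos_ge0.
  by rewrite !funeposE ge_max !le_max lexx (fh _ Dt) !orbT.
apply: mono => t Dt; first exact: funeneg_ge0.
by rewrite !funenegE ge_max !le_max lexx leeN2 (fh _ Dt) !orbT.
Qed.

Definition minorizing_primitive p G c d := exists g,
  [/\ {within `[c, d], continuous g}, {within `[c, d], continuous G} &
    forall t, c < t < d -> is_derive t (1 : R) G (g t) /\ ((g t)%:E <= p t)%E].

(** The minorant is -oo at the ends, where nothing is known of [p]; this does not
    change its integral. *)
Lemma minorant_piece p G c d : c < d -> minorizing_primitive p G c d ->
  exists k : R -> \bar R, [/\ measurable_fun `[c, d] k,
    forall t, c <= t <= d -> (k t <= p t)%E &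
    (\int[mu]_(t in `[c, d]) k t = (G d - G c)%:E)%E].
Proof.
move=> cd [g [gc Gc gp]]; pose k t := if t \in `]c, d[ then (g t)%:E else -oo%E.
have mg : measurable_fun `]c, d[ (EFin \o g).
  apply/measurable_EFinP; apply: open_continuous_measurable_fun => // t tcd.
  by apply: (within_continuous_continuous cd gc); move: tcd; rewrite inE.
have kg : {in `]c, d[%classic, EFin \o g =1 k}.
  by move=> t; rewrite inE /= /k => ->.
have mk : measurable_fun `]c, d[ k by apply: eq_measurable_fun mg.
exists k; split.
- exact: (emeasurable_fun_itv_cc mk).
- move=> t _; rewrite /k; case: ifPn => [|_]; last exact: leNye.
  by rewrite in_itv /= => /gp[].
- rewrite (integral_itv_bndoo _ _ mk).
  transitivity (\int[mu]_(t in `]c, d[) (g t)%:E)%E.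
    by apply: eq_integral => t tcd; rewrite -kg.
  rewrite -(integral_itv_bndoo true false mg) (@continuous_FTC2 _ g G)//.
  + have [_ Gr Gl] := (continuous_within_itvP G cd).1 Gc; split => // t.
    by rewrite in_itv /= => /gp[[]].
  + by move=> t; rewrite in_itv /= => /gp[[_ Gt] _]; rewrite derive1E.
Qed.

Lemma minorant_partition p G s a b : itv_partition a b s ->
  (forall i, (i < size s)%N ->
     minorizing_primitive p G (nth b (a :: s) i) (nth b (a :: s) i.+1)) ->
  exists k : R -> \bar R, [/\ measurable_fun `[a, b] k,
    forall t, a <= t <= b -> (k t <= p t)%E &
    (\int[mu]_(t in `[a, b]) k t = (G b - G a)%:E)%E].
Proof.
elim: s a => [|x s ih] a ab pieces.
  exists (fun=> -oo%E); split => [|t _|]; [exact: measurable_cst|exact: leNye|].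
  by rewrite (itv_partition_nil ab) set_itv1 integral_set1 subrr.
have ax : a < x by have [/= /andP[]] := ab.
have xb := itv_partition_cons ab.
have [k1 [mk1 k1p ik1]] := minorant_piece ax (pieces 0 isT).
have [k2 [mk2 k2p ik2]] := ih x xb (fun i => pieces i.+1).
have xb' : x <= b := itv_partition_le xb.
pose k t := if t <= x then k1 t else k2 t.
have kk1 : {in `[a, x]%classic, k1 =1 k}.
  by move=> t; rewrite inE /= in_itv /= /k => /andP[_ ->].
have kk2 : {in `]x, b]%classic, k2 =1 k}.
  by move=> t; rewrite inE /= in_itv /= => /andP[xt _]; rewrite /k leNgt xt.
have mk2' : measurable_fun `]x, b] k2 by apply/emeasurable_fun_itv_obnd_cbndP.
have split_ab : `[a, b]%classic = `[a, x] `|` `]x, b].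
  by apply: itv_bndbnd_setU; rewrite bnd_simp// ltW.
have mk : measurable_fun (`[a, x] `|` `]x, b]) k.
  apply/measurable_funU => //; split; first exact: eq_measurable_fun mk1.
  exact: eq_measurable_fun mk2'.
exists k; split; first by rewrite split_ab.
- move=> t; rewrite /k => /andP[ta tb]; case: (leP t x) => tx.
    by apply: k1p; rewrite ta.
  by apply: k2p; rewrite tb ltW.
- rewrite split_ab integral_setU//; last first.
    rewrite disj_set2E; apply/eqP; rewrite -subset0 => t [] /=; rewrite !in_itv /=.
    by move=> /andP[_ tx] /andP[xt _]; have := lt_le_trans xt tx; rewrite ltxx.
  have -> : (\int[mu]_(t in `[a, x]) k t = \int[mu]_(t in `[a, x]) k1 t)%E.
    by apply: eq_integral => t tax; rewrite -kk1.
  have -> : (\int[mu]_(t in `]x, b]) k t = \int[mu]_(t in `]x, b]) k2 t)%E.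
    by apply: eq_integral => t tax; rewrite -kk2.
  rewrite integral_itv_obnd_cbnd// ik1 ik2 -EFinD; congr EFin; ring.
Qed.

Lemma primitive_le_integral p G s a b : itv_partition a b s ->
  (forall i, (i < size s)%N ->
     minorizing_primitive p G (nth b (a :: s) i) (nth b (a :: s) i.+1)) ->
  ((G b - G a)%:E <= \int[mu]_(t in `[a, b]) p t)%E.
Proof.
move=> ab pieces; have [k [_ kp <-]] := minorant_partition ab pieces.
by apply: le_integral_pointwise => t; rewrite /= in_itv /=; exact: kp.
Qed.

End Integration.

(** * Lower bound on the length of curves *)

Section Length.
Context {R : realType} {n : nat}.
Local Notation V := 'rV[R]_n.+1.
Implicit Types (x y z v w u xi : V) (a b t d l : R).
Variable Omega : set V.
Hypothesis Os : Omega `<=` sphere.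

(** Differentiate [dot sigma sigma = 1]. *)
Lemma tangent_derive (sigma : R -> V) (ds : V) t :
  is_derive t (1 : R) sigma ds -> (\near t, sphere (sigma t)) ->
  tangent (sigma t) ds.
Proof.
move=> hs sph; have h := is_derive_dot_self hs.
have : is_derive t (1 : R) (fun s : R => dot (sigma s) (sigma s)) (0 : R).
  have c1 : is_derive t (1 : R) (cst (1 : R)) (0 : R) by exact: is_derive_cst.
  apply: near_eq_is_derive c1.
  by apply: filterS sph => s; rewrite /sphere /= => ->.
case: h => _ h1 [_ h2]; move: h1; rewrite h2 => /esym/eqP.
by rewrite mulf_eq0 pnatr_eq0 /= => /eqP.
Qed.

(** Along the curve, [- dot v (sigma') / dot v sigma] is the derivative of
    [- ln (dot v sigma)]. *)
Lemma log_functional_le_length (p : V -> V -> \bar R) v x y a b sigma :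
  positive_on Omega v ->
  (forall z xi, Omega z -> tangent z xi ->
    ((- (dot v xi / dot v z))%:E <= p z xi)%E) ->
  curve_from_to Omega x y a b sigma ->
  ((ln (dot v x / dot v y))%:E <= finsler_length p a b sigma)%E.
Proof.
move=> vO vp [ab [s abs sC1] sO sa sb].
pose G t := - ln (dot v (sigma t)).
have Osig t : a <= t <= b -> Omega (sigma t).
  by move=> tab; apply: sO; exists t => //=; rewrite in_itv.
have -> : ln (dot v x / dot v y) = G b - G a.
  rewrite ln_div ?posrE; first by rewrite /G sa sb; ring.
    by apply: vO; rewrite -sa; apply: Osig; rewrite lexx ltW.
  by apply: vO; rewrite -sb; apply: Osig; rewrite lexx ltW.
apply: (primitive_le_integral abs) => i si.
set c := nth b (a :: s) i; set d := nth b (a :: s) i.+1.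
have ac : a <= c by apply: itv_partition_nth_ge abs; rewrite ltnW.
have db : d <= b by apply: itv_partition_nth_le abs.
have [sc [ds dsc sd]] := sC1 i si.
have Ocd t : c <= t <= d -> Omega (sigma t).
  by move=> /andP[ct td]; apply: Osig; rewrite (le_trans ac ct) (le_trans td db).
exists (fun t => - (dot v (ds t) / dot v (sigma t))).
have vsc : {within `[c, d], continuous (fun t => dot v (sigma t))}.
  by apply: (@within_continuous_comp _ _ _ _ sigma (dot v)) => // z _;
    exact: dot_continuous.
have vdsc : {within `[c, d], continuous (fun t => dot v (ds t))}.
  by apply: (@within_continuous_comp _ _ _ _ ds (dot v)) => // z _; exact: dot_continuous.
have Gc : {within `[c, d], continuous G}.
  apply: (@within_continuous_comp _ _ _ _ (fun t => dot v (sigma t))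
    (fun r => - ln r)) => //.
  move=> r; rewrite inE => -[t tcd <-].
  apply: continuousN; apply: continuous_ln; apply: vO; apply: Ocd.
  by move: tcd; rewrite /= in_itv.
split => //.
  have vsi : {within `[c, d], continuous (fun t => (dot v (sigma t))^-1)}.
    apply: (@within_continuous_comp _ _ _ _ (fun t => dot v (sigma t))
      (fun r => r^-1)) => //.
    move=> r; rewrite inE => -[t tcd <-]; apply: inv_continuous; rewrite gt_eqF//.
    by apply: vO; apply: Ocd; move: tcd; rewrite /= in_itv.
  have m : {within `[c, d], continuous
      ((fun t => dot v (ds t)) \* (fun t => (dot v (sigma t))^-1))}.
    by move=> t; exact: (continuousM (vdsc t) (vsi t)).
  by apply: (@within_continuous_comp _ _ _ _ _ (fun r : R => - r)) m => r _;
    exact: opp_continuous.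
move=> t /andP[ct td]; have sdt : is_derive t (1 : R) sigma (ds t).
  by apply: sd; rewrite ct.
have Ot : Omega (sigma t) by apply: Ocd; rewrite !ltW.
split.
  have vs : is_derive t (1 : R) (fun t => dot v (sigma t)) (dot v (ds t)).
    exact: is_derive_dot.
  have ls : is_derive t (1 : R) (fun t => ln (dot v (sigma t)))
      ((dot v (sigma t))^-1 * dot v (ds t)).
    apply: (@is_derive1_comp R (@ln R) (fun t => dot v (sigma t))) => //.
    by apply: is_derive1_ln; exact: vO.
  by rewrite mulrC; apply: is_deriveN.
have -> : derive1 sigma t = ds t by rewrite derive1E; case: sdt.
apply: vp => //; apply: tangent_derive sdt _.
near=> u; apply: Os; apply: Ocd; apply/andP; split; apply: ltW.
  by near: u; exact: lt_nbhsr.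
by near: u; exact: lt_nbhsl.
Unshelve. all: by end_near. Qed.

End Length.

(** * Length of geodesics and the distance formula *)

Section ArcLength.
Context {R : realType} {n : nat}.
Local Notation V := 'rV[R]_n.+1.
Implicit Types (x y z v w u xi : V) (a b t d l : R).
Variable Omega : set V.
Hypothesis Os : Omega `<=` sphere.
Hypothesis Oo : sopen Omega.
Hypothesis Oc : sconvex Omega.

Definition great_arc_velocity x u t := (- sin t) *: x + cos t *: u.

Lemma is_derive_great_arc x u t :
  is_derive t (1 : R) (great_arc x u) (great_arc_velocity x u t).
Proof. by apply: is_derive_combination. Qed.

Lemma is_derive_great_arc_velocity x u t :
  is_derive t (1 : R) (great_arc_velocity x u) (- great_arc x u t).
Proof.
rewrite /great_arc opprD -!scaleNr; apply: is_derive_combination; exact: is_deriveN.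
Qed.

Lemma great_arc_tangent x u t : sphere x -> tangent x u -> dot u u = 1 ->
  tangent (great_arc x u t) (great_arc_velocity x u t) /\
  dot (great_arc_velocity x u t) (great_arc_velocity x u t) = 1.
Proof.
rewrite /sphere /tangent /great_arc /great_arc_velocity /= => x1 xu u1.
rewrite !(dotDl, dotDr, dotZl, dotZr) x1 u1 (dotC u x) xu; split; first by ring.
by rewrite -[RHS](cos2Dsin2 t); ring.
Qed.

(** The form [dot v] at time [l] is expressed by its value and its derivative at
    time [t]; its sign at the exit point [great_arc x u l] thus compares
    [cot (l - t)] with [- dot v (great_arc_velocity x u t) / dot v (great_arc x u t)]. *)
Lemma dot_great_arc_shift v x u l t :
  cos (l - t) * dot v (great_arc x u t) +
    sin (l - t) * dot v (great_arc_velocity x u t) = dot v (great_arc x u l).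
Proof.
rewrite -[in RHS](subrK t l) /great_arc /great_arc_velocity.
rewrite (cosD (l - t)) (sinD (l - t)) !(dotDr, dotZr); ring.
Qed.

(** The supremum is attained at a hyperplane supporting [Omega] at the exit
    point of the geodesic. *)
Lemma finsler_hit_great_arc x u l t : Omega x -> tangent x u -> dot u u = 1 ->
  0 < l - t < pi -> Omega (great_arc x u t) -> sboundary Omega (great_arc x u l) ->
  finsler_hit Omega (great_arc x u t) (great_arc_velocity x u t) =
  (cos (l - t) / sin (l - t))%:E.
Proof.
move=> Ox xu u1 ltpi Ot bl.
have [tt d1] := great_arc_tangent t (Os Ox) xu u1.
have S0 : 0 < sin (l - t) by exact: sin_gt0_pi.
have cmp v : positive_on Omega v -> cos (l - t) / sin (l - t) +
    dot v (great_arc_velocity x u t) / dot v (great_arc x u t) =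
    dot v (great_arc x u l) / (sin (l - t) * dot v (great_arc x u t)).
  move=> vO; rewrite -(dot_great_arc_shift v x u l t); field.
  by rewrite !gt_eqF//; exact: vO.
apply/eqP; rewrite eq_le; apply/andP; split.
  apply: finsler_hit_le => //; first exact: sphere_neq0.
  move=> v vO; rewrite lerNl -subr_ge0 opprK addrC cmp// divr_ge0//.
    exact: sboundary_dot_ge0 bl.
  by rewrite mulr_ge0// ltW//; exact: vO.
have [v [vO sv vl]] := exists_supporting_at Os Oo Oc Ox bl.
apply: le_trans (finsler_hit_ge Os vO sv Ot tt).
by rewrite lee_fin -subr_ge0 -opprD addrC cmp// vl mul0r oppr0.
Qed.

Lemma integral_cot d l : 0 < d < l -> l < pi ->
  (\int[lebesgue_measure]_(t in `[0%R, d]) (cos (l - t) / sin (l - t))%:E)%E =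
  (ln (sin l / sin (l - d)))%:E.
Proof.
move=> /andP[d0 dl] lpi; pose F t := - ln (sin (l - t)).
have S0 t : 0 <= t <= d -> 0 < sin (l - t).
  by move=> /andP[t0 td]; apply: sin_gt0_pi; apply/andP; split; lra.
have dlt t : is_derive t (1 : R) (fun t => l - t) (- 1).
  by rewrite -[X in is_derive _ _ _ X]add0r; apply: is_deriveB.
have dsin t : is_derive t (1 : R) (fun t => sin (l - t)) (cos (l - t) * -1).
  exact: (@is_derive1_comp R sin (fun t => l - t)).
have dcos t : is_derive t (1 : R) (fun t => cos (l - t)) (- sin (l - t) * -1).
  exact: (@is_derive1_comp R cos (fun t => l - t)).
have dF t : 0 <= t <= d -> is_derive t (1 : R) F (cos (l - t) / sin (l - t)).
  move=> td; have dln : is_derive t (1 : R) (fun t => ln (sin (l - t)))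
      ((sin (l - t))^-1 * (cos (l - t) * -1)).
    apply: (@is_derive1_comp R (@ln R) (fun t => sin (l - t))) => //.
    by apply: is_derive1_ln; exact: S0.
  rewrite (_ : _ / _ = - ((sin (l - t))^-1 * (cos (l - t) * -1))); last by ring.
  exact: is_deriveN.
have -> : ln (sin l / sin (l - d)) = F d - F 0.
  rewrite ln_div ?posrE; first by rewrite /F subr0; ring.
    by have := S0 0; rewrite subr0; apply; rewrite lexx ltW.
  by apply: S0; rewrite lexx ltW.
have cont (f : R -> R) (df : R -> R) :
    (forall t, 0 <= t <= d -> is_derive t (1 : R) f (df t)) ->
    {within `[0, d], continuous f}.
  move=> h; apply: derivable_within_continuous => t; rewrite in_itv /= => /h.
  by case.
have Fc : {within `[0, d], continuous F} by exact: cont dF.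
apply: (@continuous_FTC2 _ (fun t => cos (l - t) / sin (l - t)) F) => //.
- have sc : {within `[0, d], continuous (fun t => (sin (l - t))^-1)}.
    apply: (@within_continuous_comp _ _ _ _ (fun t => sin (l - t)) (fun r => r^-1)).
      move=> r; rewrite inE => -[t td <-]; apply: inv_continuous; rewrite gt_eqF//.
      by apply: S0; move: td; rewrite /= in_itv.
    by apply: cont => t _; exact: dsin.
  have cc : {within `[0, d], continuous (fun t => cos (l - t))}.
    by apply: cont => t _; exact: dcos.
  by move=> t; exact: (continuousM (cc t) (sc t)).
- have [_ Fr Fl] := (continuous_within_itvP F d0).1 Fc; split => // t.
  by rewrite in_itv /= => /andP[t0 td]; have [] := dF t; rewrite ?ltW.
- move=> t; rewrite in_itv /= => /andP[t0 td]; rewrite derive1E.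
  by have [|_ ->//] := dF t; rewrite !ltW.
Qed.

Lemma great_arc_curve x u d l : tangent x u -> 0 < d < l ->
  (forall s, 0 <= s < l -> Omega (great_arc x u s)) ->
  curve_from_to Omega x (great_arc x u d) 0 d (great_arc x u).
Proof.
move=> xu /andP[d0 dl] Ol.
have dcont (f df : R -> V) : (forall t, is_derive t (1 : R) f (df t)) ->
    {within `[0, d], continuous f}.
  by move=> h; apply: derivable_within_continuous => t _; have [] := h t.
split => //; last exact: great_arc0.
  exists [:: d]; first exact: itv_partition1.
  move=> [|//] _ /=; split; first by apply: dcont => t; exact: is_derive_great_arc.
  exists (great_arc_velocity x u).
    by apply: dcont => t; exact: is_derive_great_arc_velocity.
  by move=> t _; exact: is_derive_great_arc.
move=> _ [t /= + <-]; rewrite in_itv /= => /andP[t0 td].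
by apply: Ol; rewrite t0/= (le_lt_trans td).
Qed.

Lemma great_arc_length x u d l : Omega x -> tangent x u -> dot u u = 1 ->
  0 < d < l -> l < pi -> (forall s, 0 <= s < l -> Omega (great_arc x u s)) ->
  sboundary Omega (great_arc x u l) ->
  finsler_length (finsler_hit Omega) 0 d (great_arc x u) = (ln (sin l / sin (l - d)))%:E.
Proof.
move=> Ox xu u1 dl lpi Ol bl; rewrite -integral_cot//.
apply: eq_integral => t; rewrite inE /= in_itv /= => /andP[t0 td].
have tl : t < l by case/andP: dl => _; exact: le_lt_trans.
have -> : derive1 (great_arc x u) t = great_arc_velocity x u t.
  by rewrite derive1E; have [_ ->] := is_derive_great_arc x u t.
apply: finsler_hit_great_arc => //; last by apply: Ol; rewrite t0.
by apply/andP; split; lra.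
Qed.

(** If one tangent space of the sphere is trivial, the ambient space is a line
    and every tangent space is trivial. *)
Lemma tangent_eq0 x z xi : sphere x -> sphere z -> (forall w, tangent x w -> w = 0) ->
  tangent z xi -> xi = 0.
Proof.
move=> x1 z1 x0.
have dec w : w = dot x w *: x.
  apply/eqP; rewrite -subr_eq0; apply/eqP; apply: x0.
  by rewrite /tangent /= dotBr dotZr x1 mulr1 subrr.
rewrite /tangent /= => zxi; rewrite (dec xi).
have zz := z1; rewrite /sphere /= {2}(dec z) dotZr in zz.
have : dot x xi * dot z x = 0 by rewrite -dotZr -dec.
move/eqP; rewrite mulf_eq0 => /orP[/eqP ->|/eqP zx]; first by rewrite scale0r.
by move: zz; rewrite zx mulr0 => /esym/eqP; rewrite oner_eq0.
Qed.

(** Serves to bound below the length of loops.  When [n = 0] there is no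
    supporting hyperplane, but all tangent vectors are 0, so any positive form
    does. *)
Lemma exists_bounding_functional x : Omega x -> exists v, positive_on Omega v /\
  forall z xi, Omega z -> tangent z xi ->
    ((- (dot v xi / dot v z))%:E <= finsler_hit Omega z xi)%E.
Proof.
move=> Ox; have [x0|] := pselect (forall w, tangent x w -> w = 0).
  have [v _ vO] := sconvex_positive Oc Ox; exists v; split => // z xi Oz zxi.
  rewrite (tangent_eq0 (Os Ox) (Os Oz) x0 zxi) /finsler_hit eqxx.
  by rewrite dot0r mul0r oppr0.
move=> /existsNP[w /not_implyP[xw /eqP w0]].
have xu : tangent x ((enorm w)^-1 *: w) by rewrite /tangent /= dotZr xw mulr0.
have [l [_ _ _ bl]] := great_arc_exit Os Oo Oc Ox xu (sphere_normalize w0).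
have [v [vO sv _]] := exists_supporting_at Os Oo Oc Ox bl.
by exists v; split => // z xi Oz zxi; exact: finsler_hit_ge.
Qed.

Lemma constant_curve x : Omega x -> curve_from_to Omega x x 0 1 (cst x).
Proof.
move=> Ox; split => //.
  exists [:: 1]; first exact: itv_partition1.
  move=> [|//] _ /=; split; first by move=> t; exact: cst_continuous.
  by exists (cst 0); [move=> t; exact: cst_continuous|move=> t _; exact: is_derive_cst].
by move=> _ [t _ <-].
Qed.

Lemma funk_finsler_dist x y : Omega x -> Omega y ->
  (funk Omega x y)%:E = finsler_dist Omega (finsler_hit Omega) x y.
Proof.
move=> Ox Oy; apply/eqP; rewrite eq_le; apply/andP; split.
  apply/ereal_infP => _ [a [b [sigma [curve ->]]]].
  have [xy|xy] := eqVneq x y.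
    have [v [vO vp]] := exists_bounding_functional Ox.
    apply: le_trans (log_functional_le_length Os vO vp curve).
    by rewrite /funk xy eqxx divff ?ln1// gt_eqF//; exact: vO.
  have [u [d [l [xu u1 /andP[d0 dl] yE [lpi Ol bl ->]]]]] := funk_chord Os Oo Oc Ox Oy xy.
  have [v [vO sv vl]] := exists_supporting_at Os Oo Oc Ox bl.
  have vp z xi : Omega z -> tangent z xi ->
      ((- (dot v xi / dot v z))%:E <= finsler_hit Omega z xi)%E.
    by move=> Oz zxi; exact: finsler_hit_ge.
  apply: le_trans (log_functional_le_length Os vO vp curve).
  have s0 : 0 < sin (l - d) by apply: sin_gt0_pi; apply/andP; split; lra.
  have sl : 0 < sin l by apply: sin_gt0_pi; apply/andP; split; lra.
  suff -> : sin l / sin (l - d) = dot v x / dot v y by [].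
  have vx := vO _ Ox; have vy := vO _ Oy.
  have e : sin l * dot v y = sin (l - d) * dot v x.
    have h : cos l * dot v x = - (sin l * dot v u).
      by apply/eqP; rewrite -addr_eq0; apply/eqP; rewrite -!dotZr -dotDr.
    rewrite yE /great_arc dotDr !dotZr sinB.
    transitivity (sin l * cos d * dot v x + sin d * (sin l * dot v u)); first by ring.
    by rewrite -[sin l * dot v u]opprK -h; ring.
  apply: (mulIf (lt0r_neq0 vy)); apply: (mulfI (lt0r_neq0 s0)).
  transitivity (sin l * dot v y); first by field; exact: lt0r_neq0.
  by rewrite e; field; exact: lt0r_neq0.
apply: ereal_inf_lbound; have [xy|xy] := eqVneq x y.
  subst y; exists 0, 1, (cst x); split; first exact: constant_curve.
  rewrite /funk eqxx /finsler_length; apply/esym; apply: integral0_eq => t _.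
  by rewrite derive1_cst /finsler_hit eqxx.
have [u [d [l [xu u1 dl yE [lpi Ol bl ->]]]]] := funk_chord Os Oo Oc Ox Oy xy.
exists 0, d, (great_arc x u); split; first by rewrite yE; exact: great_arc_curve dl Ol.
by rewrite (great_arc_length Ox xu u1 dl lpi Ol bl).
Qed.

End ArcLength.

Theorem theorem3p13 (R : realType) (n : nat) (Omega : set 'rV[R]_n.+1)
    (Omega_sphere : Omega `<=` sphere) (Omega_neq0 : Omega !=set0)
    (Omega_open : sopen Omega) (Omega_convex : sconvex Omega)
    (Omega_diam : sdiam Omega < pi / 2) :
  (forall x xi : 'rV[R]_n.+1, Omega x -> tangent x xi ->
    finsler_hit Omega x xi = finsler_eta Omega x xi) /\
  (forall x y : 'rV[R]_n.+1, Omega x -> Omega y ->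
    (funk Omega x y)%:E = finsler_dist Omega (finsler_hit Omega) x y).
Proof.
split; first by move=> x xi; exact: finsler_hit_eta.
by move=> x y; exact: funk_finsler_dist.
Qed.
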